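(* The hyperspace $\mathcal S_P(\mathbb R^2)$ is an $F_\sigma$-subset of $C(\mathbb R^2)$ and is not a $G_\delta$-subset of $C(\mathbb R^2)$; likewise, the hyperspace $\mathcal K_P$ is an $F_\sigma$-subset of $C(\mathbb R^3)$ and is not a $G_\delta$-subset of $C(\mathbb R^3)$.
   Context: For a space $X$, $C(X)$ denotes the hyperspace of all nonempty continua (compact connected subsets) in $X$ with the Vietoris topology, whose basic open sets are $\langle U_1,\dots,U_n\rangle=\{C\in C(X): C\subset\bigcup_{k=1}^n U_k \text{ and } U_k\cap C\neq\emptyset \text{ for all } k\}$, with $n\in\mathbb N$ and $U_k$ open in $X$ (equivalently, for $X=\mathbb R^n$, the topology of the Hausdorff distance). $\mathcal S_P(\mathbb R^2)\subset C(\mathbb R^2)$ is the set of simple closed polygons in $\mathbb R^2$ (simple closed curves, i.e. homeomorphic copies of the circle, that are finite unions of straight line segments). $\mathcal K_P\subset C(\mathbb R^3)$ is the set of polygonal knots (simple closed curves in $\mathbb R^3$ that are finite unions of straight line segments). *)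

(* Defs.v *)
From HB Require Import structures.
From mathcomp Require Import all_boot all_order all_algebra.
From mathcomp Require Import all_classical all_reals all_analysis.

Set Implicit Arguments.
Unset Strict Implicit.
Unset Printing Implicit Defensive.

Import Order.TTheory GRing.Theory Num.Theory.
Import numFieldNormedType.Exports.

Local Open Scope classical_set_scope.
Local Open Scope ring_scope.

Definition continuum (X : topologicalType) (C : set X) : Prop :=
  [/\ C !=set0, compact C & connected C].

Definition hyperspace (X : topologicalType) : Type :=
  {C : set X | continuum C}.

HB.instance Definition _ (X : topologicalType) := gen_eqMixin (hyperspace X).
HB.instance Definition _ (X : topologicalType) :=
  gen_choiceMixin (hyperspace X).

Section Vietoris.
Context {X : topologicalType}.

(* The basic set <U_0, ..., U_n>. *)
Definition vietoris_box n (U : 'I_n.+1 -> set X) : set (hyperspace X) :=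
  [set C | sval C `<=` \bigcup_k U k /\ forall k, U k `&` sval C !=set0].

Definition vietoris_base : set (set (hyperspace X)) :=
  [set B | exists n (U : 'I_n.+1 -> set X),
    (forall k, open (U k)) /\ B = vietoris_box U].

Lemma vietoris_base_cover : \bigcup_(B in vietoris_base) B = setT.
Proof.
rewrite -subTset => C _; exists (vietoris_box (fun _ : 'I_1 => setT)).
  by exists 0%N, (fun=> setT); split => // _; exact: openT.
split=> [x _|_]; first by exists ord0.
by rewrite setTI; case: (svalP C).
Qed.

Lemma vietoris_base_join (A B : set (hyperspace X)) (C : hyperspace X) :
  vietoris_base A -> vietoris_base B -> A C -> B C ->
  exists D, [/\ vietoris_base D, D C & D `<=` A `&` B].
Proof.
move=> [n [U [oU ->]]] [m [V [oV ->]]] [CU UC] [CV VC].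
pose W (k : 'I_(n.+1 + m.+1)) : set X :=
  match fintype.split k with
  | inl i => U i `&` \bigcup_j V j
  | inr j => V j `&` \bigcup_i U i
  end.
have Wl i : W (lshift m.+1 i) = U i `&` \bigcup_j V j.
  by rewrite /W -[lshift _ _]/(unsplit (inl i)) unsplitK.
have Wr j : W (rshift n.+1 j) = V j `&` \bigcup_i U i.
  by rewrite /W -[rshift _ _]/(unsplit (inr j)) unsplitK.
have WP k : (exists i, W k = U i `&` \bigcup_j V j) \/
            (exists j, W k = V j `&` \bigcup_i U i).
  by rewrite /W; case: (fintype.split k) => i; [left|right]; exists i.
exists (@vietoris_box (n + m.+1)%N W); split.
- exists (n + m.+1)%N, W; split => // k.
  by case: (WP k) => -[i ->]; apply: openI => //; exact: bigcup_open.
- split=> [x Cx|k].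
    by have [i _ Uix] := CU x Cx; exists (lshift m.+1 i) => //; rewrite Wl;
      split => //; exact: CV.
  case: (WP k) => -[i ->].
    by have [x [Uix Cx]] := UC i; exists x; do 2 split => //; exact: CV.
  by have [x [Vix Cx]] := VC i; exists x; do 2 split => //; exact: CU.
- move=> D [DW WD]; split; split=> [x /DW [k _]|k].
  + by case: (WP k) => -[i ->] [] // Uix _; exists i.
  + by have [x []] := WD (lshift m.+1 k); rewrite Wl => -[Ukx _] Dx; exists x.
  + by case: (WP k) => -[i ->] [] // Uix _; exists i.
  + by have [x []] := WD (rshift n.+1 k); rewrite Wr => -[Vkx _] Dx; exists x.
Qed.

HB.instance Definition _ := isBaseTopological.Build (hyperspace X)
  vietoris_base_cover vietoris_base_join.

End Vietoris.

Definition homeomorphic (X Y : topologicalType) : Prop :=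
  exists (f : X -> Y) (g : Y -> X),
    [/\ cancel f g, cancel g f, continuous f & continuous g].

Definition circle (R : realType) : set 'rV[R]_2 :=
  [set x : 'rV[R]_2 | \sum_i x 0 i ^+ 2 = 1].
Arguments circle R : clear implicits.

(* [set_type A] carries the topology induced by the inclusion of A. *)
Definition simple_closed_curve (R : realType) (X : topologicalType)
    (C : set X) : Prop :=
  homeomorphic (set_type (circle R)) (set_type C).

Definition segment (R : realType) d (a b : 'rV[R]_d) : set 'rV[R]_d :=
  [set (1 - t) *: a + t *: b | t in `[0, 1]].

Definition finite_union_of_segments (R : realType) d (C : set 'rV[R]_d) :=
  exists n (a b : 'I_n -> 'rV[R]_d),
    (forall i, a i != b i) /\ C = \bigcup_i segment (a i) (b i).

Definition polygonal_simple_closed_curves (R : realType) d :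
    set (hyperspace 'rV[R]_d) :=
  [set C | simple_closed_curve R (sval C) /\ finite_union_of_segments (sval C)].
Arguments polygonal_simple_closed_curves R d : clear implicits.

Definition simple_closed_polygons (R : realType) : set (hyperspace 'rV[R]_2) :=
  polygonal_simple_closed_curves R 2.

Definition polygonal_knots (R : realType) : set (hyperspace 'rV[R]_3) :=
  polygonal_simple_closed_curves R 3.

Arguments simple_closed_polygons R : clear implicits.
Arguments polygonal_knots R : clear implicits.

(* Main.v *)
Require Import Defs.
From mathcomp Require Import all_boot all_order all_algebra.
From mathcomp Require Import all_classical all_reals all_analysis.
From mathcomp Require Import borel_hierarchy.
From mathcomp Require Import ring lra.

(** A simple closed curve is the image of a loop on [[0, 1]], injective except
    at its endpoints.

    F-sigma: the preimages under such a loop of the endpoints of finitely many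
    segments covering a curve cut [[0, 1]] into arcs.  An inner point of an arc
    lies on one of the segments, the two halves of that segment are connected,
    and removing the two endpoints of the arc disconnects the curve; hence each
    half contains one of these endpoints, and the arc is straight.  The curve is
    therefore a closed polygon with vertices [v_0, ..., v_(n-1)], whose piecewise
    linear parametrization by a regular n-gon is bi-Lipschitz.  The polygons with
    [n] vertices of norm at most [m] and lower Lipschitz constant [1 / m] form a
    closed set, by compactness of the set of the possible vertices.

    Not G-delta: hang below the abscissa axis a fixed polygonal line joining
    [(0, 0)] to [(1, 0)], and put above it a tent of height
    proportional to [h_n(x)] on each interval [[1 / (n + 2), 1 / (n + 1)]], where
    [h_n(x)] is the product of [min(1, |x - q_k|)] for [k < n] and [(q_k)]
    enumerates the rationals.  This curve depends continuously on [x] and is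
    polygonal exactly when [x] is rational, while the set of rationals is not
    G-delta. *)

Set Implicit Arguments.
Unset Strict Implicit.
Unset Printing Implicit Defensive.

Import Order.TTheory GRing.Theory Num.Theory.
Import numFieldNormedType.Exports.

Local Open Scope classical_set_scope.
Local Open Scope ring_scope.

(** * Loops *)

Definition simple_loop (R : realType) (X : topologicalType) (g : R -> X)
    (C : set X) :=
  [/\ continuous g, g @` `[0, 1] = C, g 0 = g 1 & {in `[0, 1[ &, injective g}].

Section simple_loop_theory.
Context {R : realType} {X : topologicalType}.
Implicit Types (g : R -> X) (C : set X).

Lemma compact_image_itv g (a b : R) : continuous g -> compact (g @` `[a, b]).
Proof.
move=> cg; apply: continuous_compact; last exact: segment_compact.
exact: continuous_subspaceT.
Qed.

Lemma simple_loopP g C : simple_loop g C ->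
  forall y, C y <-> exists2 t, t \in `[0, 1[ & g t = y.
Proof.
move=> [cg gC g01 ginj] y; rewrite -gC; split=> [[t t01 <-]|[t t01 <-]].
  have [t1|t1] := eqVneq t 1.
    by exists 0; rewrite ?bound_itvE// g01 t1.
  exists t => //; move: t01; rewrite /= !in_itv/= => /andP[-> tle1] /=.
  by rewrite lt_neqAle t1.
by exists t => //; move: t01; rewrite /= !in_itv/= => /andP[-> /ltW].
Qed.

Lemma simple_loop_inj g C s t : simple_loop g C ->
  s \in `[0, 1] -> t \in `[0, 1] -> g s = g t ->
  [\/ s = t, s = 0 /\ t = 1 | s = 1 /\ t = 0].
Proof.
move=> [cg gC g01 ginj]; rewrite !in_itv/= => /andP[s0 s1] /andP[t0 t1] gst.
have [sE|sN] := eqVneq s 1; have [tE|tN] := eqVneq t 1.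
- by constructor 1; rewrite sE tE.
- constructor 3; split=> //; apply: ginj; rewrite ?bound_itvE//.
    by rewrite in_itv/= t0 lt_neqAle tN.
  by rewrite g01 -sE.
- constructor 2; split=> //; apply: ginj; rewrite ?bound_itvE//.
    by rewrite in_itv/= s0 lt_neqAle sN.
  by rewrite g01 -tE.
- by constructor 1; apply: ginj => //; rewrite in_itv/= ?s0 ?t0 lt_neqAle ?sN ?tN.
Qed.

Lemma simple_loop_rescale g C (a b : R) : a < b -> continuous g ->
  g @` `[a, b] = C -> g a = g b -> {in `[a, b[ &, injective g} ->
  simple_loop (fun t => g (a + (b - a) * t)) C.
Proof.
move=> ab cg gC gab ginj; have ba : 0 < b - a by rewrite subr_gt0.
split.
- move=> t; apply: continuous_comp; last exact: cg.
  by apply: cvgD; [exact: cvg_cst|apply: cvgM; [exact: cvg_cst|exact: cvg_id]].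
- rewrite -gC; apply/seteqP; split=> [_ [t + <-]|_ [t + <-]].
    rewrite /= in_itv/= => /andP[t0 t1]; exists (a + (b - a) * t) => //=.
    by rewrite in_itv/=; apply/andP; split; nra.
  rewrite /= in_itv/= => /andP[ta tb]; exists ((t - a) / (b - a)).
    rewrite /= in_itv/= divr_ge0 ?subr_ge0// ?(ltW ab)//=.
    by rewrite ler_pdivrMr// mul1r lerD2r.
  by rewrite mulrCA divff ?gt_eqF// mulr1 subrKC.
- by rewrite mulr0 addr0 mulr1 subrKC.
- have abt t : t \in `[0, 1[ -> a + (b - a) * t \in `[a, b[.
    by rewrite !in_itv/= => /andP[t0 t1]; apply/andP; split; nra.
  move=> s t /abt s01 /abt t01 /(ginj _ _ s01 t01) /addrI.
  by apply: mulfI; exact: lt0r_neq0.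
Qed.

End simple_loop_theory.

(** * Curves carried by loops are homeomorphic *)

Section loop_homeomorphism.
Context {R : realType}.

(** The preimage of a closed set [B] is the image under [g] of the compact set of the parameters in
    [[0, 1]] that [h] sends into [B], and a compact set is closed in the Hausdorff space [X]. *)
Lemma loop_homeomorphic_continuous (X Y : topologicalType) (g : R -> X) (h : R -> Y)
    (C : set X) (D : set Y) (f : set_type C -> set_type D) :
  hausdorff_space X -> simple_loop g C -> simple_loop h D ->
  (forall t (y : set_type C), t \in `[0, 1[ -> g t = set_val y ->
     set_val (f y) = h t) -> continuous f.
Proof.
move=> hX gl hl fP; have [cg gC g01 ginj] := gl; have [ch hD h01 hinj] := hl.
apply: continuous_comp_initial; apply/continuous_closedP => B cB.
rewrite (_ : _ @^-1` _ =
  set_val @^-1` (g @` ([set` `[0, 1]] `&` (h @^-1` B)))); last first.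
  apply/seteqP; split=> [y /= By|y [t [t01 hBt] gty]].
    have [t t01 gt] := (simple_loopP gl (set_val y)).1 (set_valP y).
    exists t => //; split; last by rewrite /= -(fP t y).
    by apply: subset_itvl t01; rewrite bnd_simp.
  (* The hypothesis on [f] stops short of the parameter 1, which is traded for 0 since both loops
     close up. *)
  have [t1|tN1] := eqVneq t 1.
    have := fP 0 y; rewrite bound_itvE ltr01 /= => -> //; last by rewrite -gty t1.
    by rewrite h01 -t1.
  rewrite /= (fP t)//; move: t01; rewrite /= !in_itv/= => /andP[-> t1] /=.
  by rewrite lt_neqAle tN1.
apply: preimage_closed; first by move=> x _; exact: initial_continuous.
apply: compact_closed => //; apply: continuous_compact.
  exact: continuous_subspaceT.
apply: compact_closedI; first exact: segment_compact.
by apply: preimage_closed => // x _; exact: ch.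
Qed.

Lemma loop_homeomorphic (X Y : topologicalType) (g : R -> X) (h : R -> Y)
    (C : set X) (D : set Y) :
  hausdorff_space X -> hausdorff_space Y -> simple_loop g C -> simple_loop h D ->
  homeomorphic (set_type C) (set_type D).
Proof.
move=> hX hY gl hl; have gP := simple_loopP gl; have hP := simple_loopP hl.
have [cg gC g01 ginj] := gl; have [ch hD h01 hinj] := hl.
have phi (y : set_type C) : {t : R | (t \in `[0, 1[) /\ g t = set_val y}.
  by apply: cid; have [t] := (gP _).1 (set_valP y); exists t.
have psi (y : set_type D) : {t : R | (t \in `[0, 1[) /\ h t = set_val y}.
  by apply: cid; have [t] := (hP _).1 (set_valP y); exists t.
have Dh y : h (sval (phi y)) \in D.
  by rewrite inE; apply/hP; exists (sval (phi y)) => //; exact: (svalP (phi y)).1.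
have Cg y : g (sval (psi y)) \in C.
  by rewrite inE; apply/gP; exists (sval (psi y)) => //; exact: (svalP (psi y)).1.
pose f y : set_type D := SigSub (Dh y); pose f' y : set_type C := SigSub (Cg y).
have fE t y : t \in `[0, 1[ -> g t = set_val y -> set_val (f y) = h t.
  move=> t01 gty; rewrite /f /=; have [s01 gs] := svalP (phi y).
  by congr (h _); apply: ginj => //; rewrite gs.
have fE' t y : t \in `[0, 1[ -> h t = set_val y -> set_val (f' y) = g t.
  move=> t01 gty; rewrite /f' /=; have [s01 gs] := svalP (psi y).
  by congr (g _); apply: hinj => //; rewrite gs.
exists f, f'; split.
- move=> y; apply/val_inj; have [t01 gt] := svalP (phi y).
  by rewrite -[RHS]gt; exact: fE'.
- move=> y; apply/val_inj; have [t01 gt] := svalP (psi y).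
  by rewrite -[RHS]gt; exact: fE.
- exact: (loop_homeomorphic_continuous hX gl hl).
- exact: (loop_homeomorphic_continuous hY hl gl).
Qed.

End loop_homeomorphism.

(** * Loops made of two graphs *)

Section two_graphs.
Context {R : realType} (d : nat).

(** The ambient dimension is [d.+2] so that one construction serves both the plane and the space. *)
Definition plane_point (x y : R) : 'rV[R]_d.+2 :=
  \row_j (if j == 0 then x else if j == 1 then y else 0).

Lemma plane_point0 x y : plane_point x y 0 0 = x.
Proof. by rewrite mxE. Qed.

Lemma plane_point1 x y : plane_point x y 0 1 = y.
Proof. by rewrite mxE. Qed.

Lemma plane_pointE x y :
  plane_point x y = x *: plane_point 1 0 + y *: plane_point 0 1.
Proof.
apply/rowP => j; rewrite !mxE.
by do 2? case: ifP => _; rewrite ?mulr1 ?mulr0 ?addr0 ?add0r.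
Qed.

Lemma cvg_plane_point (T : Type) (F : set_system T) (FF : Filter F)
    (u v : T -> R) (x y : R) : u @ F --> x -> v @ F --> y ->
  (fun s => plane_point (u s) (v s)) @ F --> plane_point x y.
Proof.
move=> ux vy; rewrite plane_pointE.
under eq_fun do rewrite plane_pointE.
by apply: cvgD; apply: cvgZr_tmp.
Qed.

(** When [f1] and [f2] vanish at 0, this runs along the graph of [- f2] down to the origin for
    negative [t], then along the graph of [f1]. With [Num.max], continuity requires no gluing. *)
Definition two_graphs (f1 f2 : R -> R) (t : R) : 'rV[R]_d.+2 :=
  plane_point `|t| (f1 (Num.max t 0) - f2 (Num.max (- t) 0)).

Lemma two_graphs_ge0 f1 f2 t : f2 0 = 0 -> 0 <= t ->
  two_graphs f1 f2 t = plane_point t (f1 t).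
Proof.
move=> f20 t0; rewrite /two_graphs ger0_norm// (max_idPl t0).
by rewrite (max_idPr _) ?oppr_le0// f20 subr0.
Qed.

Lemma two_graphs_le0 f1 f2 t : f1 0 = 0 -> t <= 0 ->
  two_graphs f1 f2 t = plane_point (- t) (- f2 (- t)).
Proof.
move=> f20 t0; rewrite /two_graphs ler0_norm// (max_idPr t0).
by rewrite (max_idPl _) ?oppr_ge0// f20 sub0r.
Qed.

Lemma two_graphs_loop (f1 f2 : R -> R) : continuous f1 -> continuous f2 ->
  f1 0 = 0 -> f2 0 = 0 -> f1 1 = 0 -> f2 1 = 0 ->
  (forall t : R, 0 < t -> t < 1 -> 0 < f1 t + f2 t) ->
  simple_loop (fun t => two_graphs f1 f2 (-1 + (1 - -1) * t))
    (two_graphs f1 f2 @` `[-1, 1]).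
Proof.
move=> c1 c2 f10 f20 f11 f21 fpos; apply: simple_loop_rescale => //.
- move=> t; apply: cvg_plane_point; first exact: cvg_norm.
  apply: cvgB.
    apply: (@continuous_comp _ _ _ (fun t : R => Num.max t 0) f1); last exact: c1.
    by apply: continuous_max; [exact: cvg_id|exact: cvg_cst].
  apply: (@continuous_comp _ _ _ (fun t : R => Num.max (- t) 0) f2); last exact: c2.
  by apply: continuous_max; [apply: cvgN; exact: cvg_id|exact: cvg_cst].
- by rewrite two_graphs_le0 ?two_graphs_ge0 ?opprK ?f11 ?f21 ?oppr0//; lra.
(* Points of the two different graphs with a common abscissa [s] would give [f1 s + f2 s = 0],
   against the positivity assumption. *)
have sep s t : 0 <= s -> s < 1 -> -1 <= t -> t < 0 ->
    two_graphs f1 f2 s = two_graphs f1 f2 t -> s = t.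
  move=> s0 s1 t1 t0; rewrite two_graphs_ge0// two_graphs_le0 ?ltW// => E.
  have := congr1 (fun m : 'rV_d.+2 => m 0 0) E.
  have := congr1 (fun m : 'rV_d.+2 => m 0 1) E.
  rewrite !plane_point0 !plane_point1 => fE sE; rewrite -sE in fE.
  have [s00|sN] := eqVneq s 0; first by move: sE t0; rewrite s00; lra.
  have : 0 < f1 s + f2 s by apply: fpos s1; rewrite lt_neqAle eq_sym sN s0.
  by rewrite fE addNr ltxx.
move=> s t; rewrite !in_itv/= => /andP[s1 s2] /andP[t1 t2].
have [s0|s0] := leP 0 s; have [t0|t0] := leP 0 t.
- rewrite !two_graphs_ge0// => /(congr1 (fun m : 'rV_d.+2 => m 0 0)).
  by rewrite !plane_point0.
- exact: sep.
- by move=> /esym E; apply/esym/sep.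
- rewrite !two_graphs_le0 ?ltW// => /(congr1 (fun m : 'rV_d.+2 => m 0 0)).
  by rewrite !plane_point0 => /oppr_inj.
Qed.

End two_graphs.

(** * Simple closed curves as images of loops *)

Section circle.
Context {R : realType}.

Let half (t : R) : R := Num.sqrt (t * (1 - t)).

(* Sends the circle with diameter from [(0, 0)] to [(1, 0)], which is the union
   of the graphs of [half] and [- half], to the unit circle. *)
Let aff (p : 'rV[R]_2) : 'rV[R]_2 := 2 *: p - plane_point 0 1 0.

Lemma circle_loop : exists e : R -> 'rV[R]_2, simple_loop e (circle R).
Proof.
have ch : continuous half.
  move=> t; apply: continuous_comp; last exact: sqrt_continuous.
  apply: cvgM; first exact: cvg_id.
  by apply: cvgB; [exact: cvg_cst|exact: cvg_id].
have half0 : half 0 = 0 by rewrite /half mul0r sqrtr0.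
have half1 : half 1 = 0 by rewrite /half subrr mulr0 sqrtr0.
have [] := @two_graphs_loop R 0 half half ch ch half0 half0 half1 half1.
- by move=> t t0 t1; apply: addr_gt0; rewrite sqrtr_gt0 mulr_gt0 ?subr_gt0.
move=> cg gE g01 ginj; set g := (fun t : R => _) in cg gE g01 ginj.
exists (aff \o g); split.
- move=> t; apply: cvgB; last exact: cvg_cst.
  by apply: cvgZl_tmp; exact: cg.
- rewrite -image_comp gE; apply/seteqP; split.
  + move=> _ [_ [t /= +  <-] <-]; rewrite in_itv/= => /andP[t1 t2].
    suff aux x y : y ^+ 2 = x * (1 - x) -> circle R (aff (plane_point 0 x y)).
      have [t0|t0] := leP 0 t.
        rewrite (two_graphs_ge0 _ _ half0 t0); apply: aux.
        by rewrite sqr_sqrtr// mulr_ge0// subr_ge0.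
      rewrite (two_graphs_le0 _ _ half0 (ltW t0)); apply: aux.
      by rewrite sqrrN sqr_sqrtr// mulr_ge0//; lra.
    by move=> E; rewrite /circle /= big_ord_recl big_ord1 !mxE/=; nra.
  + move=> p; rewrite /circle /= big_ord_recl big_ord1 /=.
    have -> : lift ord0 ord0 = 1 :> 'I_2 by exact/val_inj.
    have -> : ord0 = 0 :> 'I_2 by [].
    have : p = plane_point 0 (p 0 0) (p 0 1).
      by apply/rowP => -[[|[|//]] i]; rewrite mxE /=; congr (p 0 _); exact/val_inj.
    move: (p 0 0) (p 0 1) => x y -> E.
    (* The point that [aff] sends to [(x, y)] is [((x + 1) / 2, y / 2)]; the sign of [y] tells on
       which graph it lies. *)
    have xE : (y / 2) ^+ 2 = (x + 1) / 2 * (1 - (x + 1) / 2) by nra.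
    have [y0|y0] := leP 0 y.
      exists (plane_point 0 ((x + 1) / 2) (y / 2)).
        exists ((x + 1) / 2); first by rewrite /= in_itv/=; apply/andP; split; nra.
        rewrite two_graphs_ge0//; last by nra.
        by rewrite /half -xE sqrtr_sqr ger0_norm//; lra.
      by apply/rowP => i; rewrite !mxE; do 2? case: ifP => _; lra.
    exists (plane_point 0 ((x + 1) / 2) (y / 2)).
      exists (- ((x + 1) / 2)); first by rewrite /= in_itv/=; apply/andP; split; nra.
      rewrite two_graphs_le0//; last by nra.
      by rewrite opprK /half -xE sqrtr_sqr ler0_norm ?opprK//; lra.
    by apply/rowP => i; rewrite !mxE; do 2? case: ifP => _; lra.
- by congr (aff _).
- move=> s t s01 t01 /addIr /scalerI E; apply: ginj => //; apply: E; lra.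
Qed.

Lemma simple_closed_curveP (X : topologicalType) (C : set X) :
  hausdorff_space X ->
  simple_closed_curve R C <-> exists g : R -> X, simple_loop g C.
Proof.
move=> hX; have [e el] := circle_loop; split; last first.
  by case=> g gl; apply: (loop_homeomorphic _ _ el gl) => //; exact: norm_hausdorff.
move=> [f [f' [fK f'K cf cf']]]; have [ce eC e01 einj] := el.
(* A loop is a function on the whole line, but [e] is known to land in the circle only on [[0, 1]];
   hence the retraction onto this interval. *)
pose clamp (t : R) := Num.min 1 (Num.max 0 t).
have clamp01 t : clamp t \in `[0, 1].
  by rewrite in_itv /= le_min ler01 le_max lexx /= ge_min lexx.
have clampE t : t \in `[0, 1] -> clamp t = t.
  by rewrite in_itv /= => /andP[t0 t1]; rewrite /clamp (max_idPr t0) (min_idPr t1).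
have eK t : e (clamp t) \in circle R.
  by apply/mem_set; rewrite -eC; exists (clamp t) => //; exact: clamp01.
pose e' t : set_type (circle R) := SigSub (eK t).
have ce' : continuous e'.
  apply: continuous_comp_initial => t.
  apply: (@continuous_comp _ _ _ clamp e); last exact: ce.
  apply: continuous_min; first exact: cvg_cst.
  by apply: continuous_max; [exact: cvg_cst|exact: cvg_id].
have e'inj s t : s \in `[0, 1] -> t \in `[0, 1] -> e' s = e' t -> e s = e t.
  by move=> s01 t01 /(congr1 val) /=; rewrite !clampE.
exists (fun t => set_val (f (e' t))); split.
- move=> t; apply: (@continuous_comp _ _ _ (f \o e') set_val).
    by apply: continuous_comp; [exact: ce'|exact: cf].
  exact: initial_continuous.
- apply/seteqP; split=> [_ [t _ <-]|y Cy]; first exact: set_valP.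
  pose z : set_type C := SigSub (mem_set Cy).
  have := set_valP (f' z); rewrite -{1}eC => -[t t01 et]; exists t => //=.
  rewrite -[RHS]/(set_val z) -(f'K z); congr (set_val (f _)).
  by apply: val_inj; rewrite /= clampE.
- congr (set_val (f _)); apply: val_inj => /=.
  by rewrite !clampE ?bound_itvE.
- move=> s t s01 t01 /val_inj /(can_inj fK) /e'inj E; apply: einj => //; apply: E.
    exact: subset_itv_co_cc s01.
  exact: subset_itv_co_cc t01.
Qed.

End circle.

(** * Not G-delta *)

Lemma continuous_at_pair (X Y Z : topologicalType) (f : X -> Y) (g : X -> Z) (x : X) :
  {for x, continuous f} -> {for x, continuous g} ->
  {for x, continuous (fun s => (f s, g s))}.
Proof. exact: cvg_pair. Qed.

(** * Continuous maps into the hyperspace *)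

Section hyperspace_maps.
Context {X : topologicalType}.

Lemma open_vietoris_box n (U : 'I_n.+1 -> set X) :
  (forall k, open (U k)) -> open (vietoris_box U).
Proof.
move=> oU; exists [set vietoris_box U]; last by rewrite bigcup_set1.
by move=> _ ->; exists n, U.
Qed.

Lemma nbhs_hyperspaceP (C : hyperspace X) (A : set (hyperspace X)) :
  nbhs C A <-> exists n (U : 'I_n.+1 -> set X),
    [/\ forall k, open (U k), vietoris_box U C & vietoris_box U `<=` A].
Proof.
split=> [|[n [U [oU UC UA]]]].
  rewrite nbhsE => -[B [[DB sDB <-] [V DV VC]] BA].
  have [n [U [oU VE]]] := sDB _ DV; exists n, U; split=> //.
    by rewrite -VE.
  by apply: subset_trans BA; rewrite -VE; exact: bigcup_sup.
by apply: filterS UA _; apply: open_nbhs_nbhs; split=> //; exact: open_vietoris_box.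
Qed.

Lemma image_continuum {Y : topologicalType} (K : set Y) (g : Y -> X) :
  continuum K -> continuous g -> continuum (g @` K).
Proof.
move=> [[x Kx] cK coK] cg; split.
- by exists (g x), x.
- by apply: continuous_compact => //; exact: continuous_subspaceT.
- by apply: connected_continuous_connected => //; exact: continuous_subspaceT.
Qed.

(** Inclusion in the union of the [U k] persists near [z] by the tube lemma over the compact set
    [K]; meeting a given [U k] persists because a single parameter [y] witnesses it. *)
Lemma hyperspace_continuous {Z Y : topologicalType} (K : set Y)
    (g : Z -> Y -> X) (F : Z -> hyperspace X) :
  compact K -> continuous (fun p => g p.1 p.2) ->
  (forall z, sval (F z) = g z @` K) -> continuous F.
Proof.
move=> /compact_near_coveringP cK cg FE z A /nbhs_hyperspaceP[n [U [oU [FU UF] UA]]].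
have inU : \forall w \near z, K `<=` fun y => (\bigcup_k U k) (g w y).
  apply: cK => y Ky.
  have Ugy : (\bigcup_k U k) (g z y) by apply: FU; rewrite FE; exists y.
  have : nbhs (g z y) (\bigcup_k U k).
    by apply: open_nbhs_nbhs; split=> //; exact: bigcup_open.
  move=> /(cg (z, y)) [[/= P Q] [nP nQ] PQ].
  by exists (Q, P) => //= -[y' w'] [/= Qy' Pw']; exact: (PQ (w', y')).
have meetU : \forall w \near z, forall k, U k `&` sval (F w) !=set0.
  apply: filter_forall => k; have [x [Ux]] := UF k.
  rewrite FE => -[y Ky yE]; rewrite -{}yE in Ux.
  have /(cg (z, y)) [[/= P Q] [nP nQ] PQ] : nbhs (g z y) (U k).
    exact: open_nbhs_nbhs.
  apply: filterS nP => w' Pw'; exists (g w' y); split.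
    by apply: (PQ (w', y)); split=> //=; exact: nbhs_singleton.
  by rewrite FE; exists y.
change (\forall w \near z, A (F w)).
apply: filterS2 inU meetU => w Kw Uw; apply: UA; split=> //.
by rewrite FE => _ [y Ky <-]; exact: Kw.
Qed.

End hyperspace_maps.

Lemma preimage_Gdelta {S T : topologicalType} (f : S -> T) (A : set T) :
  continuous f -> Gdelta A -> Gdelta (f @^-1` A).
Proof.
move=> /continuousP cf [B oB ->]; exists (fun i => f @^-1` B i).
  by move=> i; exact: cf.
by rewrite preimage_bigcap.
Qed.

(** * Finite unions of segments and piecewise affine graphs *)

Section unions_of_segments.
Context {R : realType} {d : nat}.

Lemma finite_union_of_segmentsU (A B : set 'rV[R]_d) :
  finite_union_of_segments A -> finite_union_of_segments B ->
  finite_union_of_segments (A `|` B).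
Proof.
move=> [n [a [b [ab ->]]]] [m [a' [b' [ab' ->]]]].
pose u (f : 'I_n -> 'rV[R]_d) (g : 'I_m -> 'rV[R]_d) k :=
  match fintype.split k with inl i => f i | inr j => g j end.
have ul f g i : u f g (lshift m i) = f i.
  by rewrite /u -[lshift _ _]/(unsplit (inl i)) unsplitK.
have ur f g j : u f g (rshift n j) = g j.
  by rewrite /u -[rshift _ _]/(unsplit (inr j)) unsplitK.
exists (n + m)%N, (u a a'), (u b b'); split.
  by move=> k; rewrite /u; case: fintype.split.
apply/seteqP; split=> [x [[i _]|[j _]]|x [k _]].
- by exists (lshift m i) => //; rewrite !ul.
- by exists (rshift n j) => //; rewrite !ur.
- by rewrite /u; case: fintype.split => i; [left|right]; exists i.
Qed.

Lemma segment_union_of_segments (a b : 'rV[R]_d) : a != b ->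
  finite_union_of_segments (segment a b).
Proof.
move=> ab; exists 1%N, (fun=> a), (fun=> b); split=> //.
by apply/seteqP; split=> [x|x [_ _]//]; exists ord0.
Qed.

End unions_of_segments.

Section graphs.
Context {R : realType} (d : nat).
Local Notation plane_point := (@plane_point R d).

Definition graph_over (f : R -> R) (a b : R) : set 'rV[R]_d.+2 :=
  (fun t => plane_point t (f t)) @` `[a, b].

Lemma graph_over_affine (f : R -> R) (a b u v : R) : a < b ->
  (forall t, a <= t -> t <= b -> f t = u * t + v) ->
  finite_union_of_segments (graph_over f a b).
Proof.
move=> ab fE; set P := fun t => plane_point t (f t).
have PE s : 0 <= s -> s <= 1 ->
    P ((1 - s) * a + s * b) = (1 - s) *: P a + s *: P b.
  move=> s0 s1; have tab : a <= (1 - s) * a + s * b /\ (1 - s) * a + s * b <= b by nra.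
  rewrite /P (fE _ tab.1 tab.2) (fE _ (lexx a) (ltW ab)) (fE _ (ltW ab) (lexx b)).
  by apply/rowP => i; rewrite !mxE; do 2? case: ifP => _; lra.
rewrite (_ : graph_over f a b = segment (P a) (P b)).
  apply: segment_union_of_segments; apply: contraTneq ab.
  move=> /(congr1 (fun m : 'rV_d.+2 => m 0 0)).
  by rewrite !plane_point0 => ->; rewrite ltxx.
apply/seteqP; split=> [_ [t + <-]|_ [s + <-]]; rewrite /= in_itv/= => /andP[t0 t1].
  have ba : 0 < b - a by rewrite subr_gt0.
  have s0 : 0 <= (t - a) / (b - a) by rewrite divr_ge0// ?subr_ge0// ltW.
  have s1 : (t - a) / (b - a) <= 1 by rewrite ler_pdivrMr// mul1r lerD2r.
  exists ((t - a) / (b - a)); first by rewrite /= in_itv/= s0.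
  by rewrite -PE//; congr P; field; exact: lt0r_neq0.
exists ((1 - s) * a + s * b); first by rewrite /= in_itv/=; apply/andP; split; nra.
exact: PE.
Qed.

Lemma graph_over_cat (f : R -> R) (a b c : R) : a <= b -> b <= c ->
  finite_union_of_segments (graph_over f a b) ->
  finite_union_of_segments (graph_over f b c) ->
  finite_union_of_segments (graph_over f a c).
Proof.
move=> ab bc fab fbc.
rewrite (_ : graph_over f a c = graph_over f a b `|` graph_over f b c).
  exact: finite_union_of_segmentsU.
apply/seteqP; split=> [_ [t + <-]|_ [] [t + <-]]; rewrite /= in_itv/= => /andP[t0 t1].
- have [tb|bt] := leP t b; [left|right]; exists t => //=; rewrite in_itv/=.
    by rewrite t0.
  by rewrite (ltW bt).
- by exists t => //=; rewrite in_itv/= t0 (le_trans t1).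
- by exists t => //=; rewrite in_itv/= t1 (le_trans ab).
Qed.

Lemma two_graphsE (f1 f2 : R -> R) : f1 0 = 0 -> f2 0 = 0 ->
  two_graphs d f1 f2 @` `[-1, 1] =
  graph_over f1 0 1 `|` graph_over (fun t => - f2 t) 0 1.
Proof.
move=> f10 f20; apply/seteqP; split=> [_ [t + <-]|_ [] [t + <-]];
  rewrite /= in_itv/= => /andP[t0 t1].
- have [tp|tn] := leP 0 t; [left|right].
    by exists t; rewrite ?two_graphs_ge0//= in_itv/= tp.
  by exists (- t); rewrite ?two_graphs_le0 ?ltW//= in_itv/=; lra.
- by exists t; rewrite ?two_graphs_ge0//= in_itv/= t1 andbT; lra.
- exists (- t); first by rewrite /= in_itv/=; lra.
  by rewrite two_graphs_le0 ?opprK// oppr_le0.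
Qed.

End graphs.
Arguments graph_over {R} d f a b.

(** * The curves with tents accumulating at the origin *)

Section zigzag.
Context {R : realType}.
Implicit Types (x t : R) (n k : nat).

(** The default value 0 is itself rational, so the sequence takes exactly the rational values. *)
Let q k : R := ratr (odflt 0 (unpickle k : option rat)).

(* The heights [height n x] vanish for large [n] exactly when [x] is rational. *)
Definition height n x : R := \prod_(k < n) Num.min 1 `|x - q k|.

Let a n : R := n.+1%:R^-1.

Definition tent n t : R := Num.max 0 (Num.min (t - a n.+1) (a n - t)).

(** For each [t] at most one term is nonzero, so the supremum merely glues the peaks together;
    bounds that are uniform in [n] carry over to it. *)
Definition zigzag x t : R := sup (range (fun n => height n x * tent n t)).

Lemma height_itv n x : 0 <= height n x <= 1.
Proof.
rewrite /height; elim: n => [|n]; first by rewrite big_ord0 ler01 lexx.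
rewrite big_ord_recr /=; set h := \prod_(i < n) _ => /andP[h0 h1].
have m0 : 0 <= Num.min 1 `|x - q n| by rewrite le_min ler01 normr_ge0.
have m1 : Num.min 1 `|x - q n| <= 1 by rewrite ge_min lexx.
by rewrite mulr_ge0//= mulr_ile1.
Qed.

Lemma height_rational x : rational x -> exists N, forall n, (N <= n)%N -> height n x = 0.
Proof.
move=> [r _ <-]; exists (pickle r).+1 => n rn; apply/eqP; rewrite prodf_seq_eq0.
apply/hasP; exists (Ordinal rn); first exact: mem_index_enum.
have -> : q (Ordinal rn) = ratr r by rewrite /q pickleK.
by rewrite subrr normr0 (min_idPr ler01) eqxx.
Qed.

Lemma height_irrational n x : ~ rational x -> 0 < height n x.
Proof.
move=> xirr; apply: prodr_gt0 => k _; rewrite lt_min ltr01 normr_gt0 subr_eq0.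
by apply/eqP => xE; apply: xirr; rewrite xE; exists (odflt 0 (unpickle k)).
Qed.

Lemma height_continuous n : continuous (height n).
Proof.
rewrite /height; elim: n => [|n IH] x.
  by under eq_fun do rewrite big_ord0; exact: cvg_cst.
under eq_fun do rewrite big_ord_recr /=.
apply: cvgM; first exact: IH.
apply: (@continuous_min _ _ (fun=> 1) (fun y : R => `|y - q n|)).
  exact: cvg_cst.
by apply: cvg_norm; apply: cvgB; [exact: cvg_id|exact: cvg_cst].
Qed.

Let a_gt0 n : 0 < a n. Proof. by rewrite invr_gt0. Qed.

Let a_le n m : (n <= m)%N -> a m <= a n.
Proof. by move=> nm; rewrite lef_pV2 ?posrE// ler_nat. Qed.

Let aB n : a n - a n.+1 = a n * a n.+1.
Proof.
rewrite /a -[n.+2%:R]natr1; have : 0 < n.+1%:R :> R by [].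
by move: n.+1%:R => x x0; field; apply/andP; split; lra.
Qed.

Let a_lt n : a n.+1 < a n.
Proof. by rewrite -subr_gt0 aB mulr_gt0 ?a_gt0. Qed.

Let a_small (e : R) : 0 < e -> exists N, forall n, (N <= n)%N -> a n < e.
Proof.
move=> e0; exists (Num.truncn e^-1) => n Nn.
rewrite -[e]invrK ltf_pV2 ?posrE ?invr_gt0//.
by apply: lt_le_trans (truncnS_gt _) _; rewrite ler_nat.
Qed.

Lemma tent_ge0 n t : 0 <= tent n t.
Proof. by rewrite le_max lexx. Qed.

Lemma tent_le n t : tent n t <= a n.
Proof.
rewrite ge_max ltW ?a_gt0//= ge_min; have := a_gt0 n.+1; have := a_gt0 n.
have := a_lt n.
by have [t0|t0] := leP 0 t => H1 H2 H3; apply/orP; [right|left]; lra.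
Qed.

Lemma tent_eq0 n t : t <= a n.+1 \/ a n <= t -> tent n t = 0.
Proof.
move=> H; apply/max_idPl; rewrite ge_min.
by case: H => H; apply/orP; [left|right]; lra.
Qed.

Lemma tent_continuous n : continuous (tent n).
Proof.
move=> t; apply: (@continuous_max _ _ (fun=> 0)
  ((fun t => t - a n.+1) \min (fun t => a n - t))); first exact: cvg_cst.
by apply: continuous_min; apply: cvgB; (exact: cvg_cst || exact: cvg_id).
Qed.

Lemma peak_ge0 n x t : 0 <= height n x * tent n t.
Proof. by rewrite mulr_ge0 ?tent_ge0//; case/andP: (height_itv n x). Qed.

Lemma peak_le n x t : height n x * tent n t <= a n.
Proof.
have /andP[h0 h1] := height_itv n x.
by apply: le_trans (tent_le n t); rewrite ler_piMl// tent_ge0.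
Qed.

Lemma zigzag_ge n x t : height n x * tent n t <= zigzag x t.
Proof.
apply: ub_le_sup; last by exists n.
exists 1 => _ [k _ <-]; apply: le_trans (peak_le _ _ _) _.
by rewrite -[leRHS]invr1 -/(a 0) a_le.
Qed.

Lemma zigzag_le x t e : (forall n, height n x * tent n t <= e) -> zigzag x t <= e.
Proof.
move=> H; apply: ge_sup; first by exists (height 0 x * tent 0 t), 0%N.
by move=> _ [n _ <-].
Qed.

Lemma zigzag_ge0 x t : 0 <= zigzag x t.
Proof. exact: le_trans (peak_ge0 0 x t) (zigzag_ge _ _ _). Qed.

Lemma zigzag_eq0 x t : (forall n, height n x * tent n t = 0) -> zigzag x t = 0.
Proof.
move=> H; apply/eqP; rewrite eq_le zigzag_ge0 andbT.
by apply: zigzag_le => n; rewrite H.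
Qed.

Lemma zigzag0 x : zigzag x 0 = 0.
Proof.
apply: zigzag_eq0 => n; rewrite tent_eq0 ?mulr0//; left; exact/ltW/a_gt0.
Qed.

Lemma zigzag1 x : zigzag x 1 = 0.
Proof.
apply: zigzag_eq0 => n; rewrite tent_eq0 ?mulr0//; right.
by rewrite -[leRHS]invr1 -/(a 0) a_le.
Qed.

Lemma zigzagE k x t : a k.+1 <= t -> t <= a k ->
  zigzag x t = height k x * Num.min (t - a k.+1) (a k - t).
Proof.
move=> t1 t2; have -> : Num.min (t - a k.+1) (a k - t) = tent k t.
  by apply/esym/max_idPr; rewrite le_min !subr_ge0 t1.
apply/eqP; rewrite eq_le zigzag_ge andbT; apply: zigzag_le => n.
have [->//|nk] := eqVneq n k; rewrite tent_eq0 ?mulr0 ?peak_ge0//.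
move: nk; rewrite neq_ltn => /orP[nk|kn]; [left|right].
  exact: le_trans t2 (a_le nk).
by apply: le_trans t1; exact: a_le.
Qed.

Lemma zigzag_le0 N x t : (forall n, (N <= n)%N -> height n x = 0) ->
  t <= a N -> zigzag x t = 0.
Proof.
move=> H tN; apply: zigzag_eq0 => n; have [/H ->|nN] := leqP N n.
  by rewrite mul0r.
by rewrite tent_eq0 ?mulr0//; left; exact: le_trans tN (a_le nN).
Qed.

(** The peaks of index at least [N] stay between 0 and [e] everywhere, and the finitely many others
    are continuous; so all terms move by at most [e], and so does their supremum. *)
Lemma zigzag_continuous : continuous (fun p : R * R => zigzag p.1 p.2).
Proof.
move=> [x t]; apply/cvgrPdist_le => e e0 /=.
have [N aN] := a_small e0.
pose u n (p : R * R) : R := height n p.1 * tent n p.2.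
have cu n : {for (x, t), continuous (u n)}.
  apply: cvgM.
    apply: (@continuous_comp _ _ _ fst (height n)); first exact: cvg_fst.
    exact: height_continuous.
  apply: (@continuous_comp _ _ _ snd (tent n)); first exact: cvg_snd.
  exact: tent_continuous.
have : \forall p \near (x, t), forall n : 'I_N, `|u n (x, t) - u n p| <= e.
  apply: (@filter_forall _ _ (fun (n : 'I_N) p => `|u n (x, t) - u n p| <= e)
    (nbhs ((x, t) : R * R))) => n.
  by have /cvgrPdist_le := cu n; exact.
apply: filterS => p Hp.
have {}Hp n : `|u n (x, t) - u n p| <= e.
  have [Nn|nN] := leqP N n; last exact: Hp (Ordinal nN).
  have := peak_ge0 n x t; have := peak_le n x t.
  have := peak_ge0 n p.1 p.2; have := peak_le n p.1 p.2.
  have := aN n Nn; rewrite /u /= ler_norml => *; lra.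
have [H1 H2] : zigzag p.1 p.2 <= zigzag x t + e /\ zigzag x t <= zigzag p.1 p.2 + e.
  split; apply: zigzag_le => n; have := Hp n; rewrite ler_norml /u /= => /andP[].
    by have := zigzag_ge n x t; lra.
  by have := zigzag_ge n p.1 p.2; lra.
by rewrite ler_norml; lra.
Qed.

(** The fixed polygonal line below the abscissa axis is the graph of [- base]. *)
Definition base t : R := Num.min t (1 - t).

Section zigzag_loop.
Variable d : nat.

Definition zigzag_curve x : set 'rV[R]_d.+2 :=
  two_graphs d (zigzag x) base @` `[-1, 1].

Lemma base0 : base 0 = 0. Proof. by apply/min_idPl; rewrite subr0. Qed.
Lemma base1 : base 1 = 0. Proof. by rewrite /base subrr; apply/min_idPr. Qed.

Lemma base_continuous : continuous base.
Proof.
move=> t; apply: (@continuous_min _ _ id (fun t => 1 - t)); first exact: cvg_id.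
by apply: cvgB; [exact: cvg_cst|exact: cvg_id].
Qed.

Lemma zigzag_curve_loop x : exists g : R -> 'rV[R]_d.+2, simple_loop g (zigzag_curve x).
Proof.
eexists; apply: two_graphs_loop; rewrite ?zigzag0 ?zigzag1 ?base0 ?base1//.
- move=> t; apply: (@continuous_comp _ _ _ (fun t => (x, t)) (fun p => zigzag p.1 p.2)).
    by apply: continuous_at_pair; [exact: cvg_cst|exact: cvg_id].
  exact: zigzag_continuous.
- exact: base_continuous.
- move=> t t0 t1; apply: ltr_wpDl; first exact: zigzag_ge0.
  by rewrite lt_min t0 subr_gt0.
Qed.

(** Only finitely many peaks survive, each made of two affine pieces that meet at the midpoint of
    its interval, and the graph is flat next to the origin. *)
Lemma zigzag_curve_rational x : rational x -> finite_union_of_segments (zigzag_curve x).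
Proof.
move=> /height_rational[N HN]; rewrite /zigzag_curve two_graphsE ?zigzag0 ?base0//.
have piece k : finite_union_of_segments (graph_over d (zigzag x) (a k.+1) (a k)).
  have ak := a_lt k; pose m := (a k + a k.+1) / 2.
  have m1 : a k.+1 < m by rewrite /m; lra.
  have m2 : m < a k by rewrite /m; lra.
  apply: (graph_over_cat (ltW m1) (ltW m2)).
    apply: (@graph_over_affine _ _ _ _ _ (height k x) (- height k x * a k.+1)) => //.
    move=> t t1 t2.
    rewrite (@zigzagE k)//; last by lra.
    by rewrite (min_idPl _); [ring|rewrite /m in t2; lra].
  apply: (@graph_over_affine _ _ _ _ _ (- height k x) (height k x * a k)) => // t t1 t2.
  rewrite (@zigzagE k)//; last by lra.
  by rewrite (min_idPr _); [ring|rewrite /m in t1; lra].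
have a0 : a 0 = 1 by rewrite /a invr1.
have pieces k : finite_union_of_segments (graph_over d (zigzag x) (a k.+1) 1).
  elim: k => [|k IH]; first by rewrite -a0.
  apply: graph_over_cat IH => //; first exact/ltW/a_lt.
  by rewrite -a0 a_le.
apply: finite_union_of_segmentsU.
  apply: graph_over_cat (pieces N); first exact/ltW/a_gt0.
    by rewrite -a0 a_le.
  apply: (@graph_over_affine _ _ _ _ _ (0) (0)); first exact: a_gt0.
  move=> t _ t2; rewrite mul0r add0r; apply: zigzag_le0 HN _.
  by apply: le_trans t2 _; exact/ltW/a_lt.
apply: (@graph_over_cat _ _ _ _ 2^-1); try lra.
  apply: (@graph_over_affine _ _ _ _ _ (-1) (0)); first by lra.
  by move=> t t1 t2; rewrite /base (min_idPl _); lra.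
apply: (@graph_over_affine _ _ _ _ _ (1) (-1)); first by lra.
by move=> t t1 t2; rewrite /base (min_idPr _); lra.
Qed.

Let frequently_small_eq0 (z M : R) :
  (forall K, exists2 k, (K <= k)%N & `|z| <= M * a k) -> z = 0.
Proof.
move=> H; apply/eqP; rewrite -normr_le0 leNgt; apply/negP => z0.
have [K aK] := a_small (divr_gt0 z0 (ltr_pwDl ltr01 (normr_ge0 M))).
have [k Kk zk] := H K; have := aK k Kk.
rewrite ltr_pdivlMr ?ltr_pwDl// => H1.
have := a_gt0 k; have := ler_norm M; nra.
Qed.

(* A segment containing points of the curve over arbitrarily small abscissas
   lies on a line through the origin, but the peaks have positive slopes tending
   to [0]. *)
Lemma zigzag_curve_irrational x : ~ rational x ->
  ~ finite_union_of_segments (zigzag_curve x).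
Proof.
move=> xirr [n [p [r [_ CE]]]].
(* Abscissa and ordinate of the summit of the peak of index [k]. *)
pose m k := (a k + a k.+1) / 2; pose h k := height k x * ((a k - a k.+1) / 2).
have mk k : 0 < m k /\ m k <= a k.
  by rewrite /m; have := a_gt0 k; have := a_gt0 k.+1; have := a_lt k; lra.
(* The slope from the origin to the summit is at most [a k]: the interval has width [a k * a k.+1],
   which is negligible against its distance to 0. *)
have hk k : 0 < h k /\ h k <= m k * a k.
  rewrite /h aB; have := a_gt0 k; have := a_gt0 k.+1 => a1 a2.
  have /andP[_ h1] := height_itv k x; have h0 := height_irrational k xirr; split.
    by rewrite mulr_gt0// divr_gt0// mulr_gt0.
  apply: (@le_trans _ _ (a k * a k.+1 / 2)).
    by rewrite ler_piMl// divr_ge0// mulr_ge0// ltW.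
  by rewrite /m; nra.
have Pk k : zigzag_curve x (plane_point d (m k) (h k)).
  rewrite /zigzag_curve two_graphsE ?zigzag0 ?base0//; left.
  have ak := a_lt k; have a0 := a_gt0 k.+1; have a1 := @a_le 0 k isT.
  exists (m k).
    rewrite /= in_itv/=; rewrite [a 0]invr1 in a1; have [m0 m1] := mk k.
    by rewrite ltW//= (le_trans m1).
  have mE : a k.+1 <= m k /\ m k <= a k by rewrite /m; lra.
  rewrite (zigzagE _ mE.1 mE.2) (min_idPl _) /m; last by lra.
  by congr (plane_point _ _ (_ * _)); lra.
clearbody m h.
(* Pigeonhole: if each segment missed all summits from index [K i] on, the summit whose index is the
   maximum of the [K i] would lie on none. *)
have [i iP] : exists i, forall K, exists2 k, (K <= k)%N &
    segment (p i) (r i) (plane_point d (m k) (h k)).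
  apply: contrapT => /forallNP H.
  have {}H i : exists K, forall k, (K <= k)%N ->
      ~ segment (p i) (r i) (plane_point d (m k) (h k)).
    have /existsNP[K HK] := H i; exists K => k Kk seg; apply: HK; by exists k.
  have [K HK] := choice H.
  have := Pk (\max_i K i)%N; rewrite CE => -[i _]; apply: HK.
  exact: leq_bigmax.
pose A := r i 0 0 - p i 0 0; pose B := r i 0 1 - p i 0 1.
pose G := A * p i 0 1 - B * p i 0 0.
(* The line of the chosen segment, read in the first two coordinates. Letting [k] grow gives
   [G = 0], then [B = 0] after division by [m k], and finally [A = 0] since [h k] is positive. *)
have line k : segment (p i) (r i) (plane_point d (m k) (h k)) ->
    A * h k = B * m k + G.
  move=> [s _ E].
  have := congr1 (fun m : 'rV_d.+2 => m 0 0) E.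
  have := congr1 (fun m : 'rV_d.+2 => m 0 1) E.
  rewrite !plane_point0 !plane_point1 !mxE => <- <-.
  by rewrite /G /A /B; ring.
have G0 : G = 0.
  apply: (@frequently_small_eq0 _ (`|A| + `|B|)) => K.
  have [k Kk /line E] := iP K; exists k => //.
  have -> : G = A * h k - B * m k by lra.
  have [m0 m1] := mk k; have [h0 h1] := hk k; have ak := a_gt0 k.
  have a1 : a k <= 1 by rewrite -[leRHS]invr1 -/(a 0) a_le.
  apply: le_trans (ler_normB _ _) _; rewrite !normrM mulrDl.
  rewrite (gtr0_norm h0) (gtr0_norm m0).
  apply: lerD; apply: ler_wpM2l => //; nra.
have B0 : B = 0.
  apply: (@frequently_small_eq0 _ `|A|) => K.
  have [k Kk /line E] := iP K; exists k => //.
  have [m0 m1] := mk k; have [h0 h1] := hk k.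
  rewrite -(ler_pM2r m0) -mulrA [a k * _]mulrC.
  rewrite -{1}(gtr0_norm m0) -normrM; have -> : B * m k = A * h k by lra.
  by rewrite normrM (gtr0_norm h0) ler_wpM2l.
have A0 : A = 0.
  have [k _ /line E] := iP 0%N; have [h0 _] := hk k.
  by apply/eqP; have /eqP := E; rewrite G0 B0 mul0r addr0 mulf_eq0 (gt_eqF h0) orbF.
(* The segment now has constant abscissa, yet it carries summits whose positive abscissas become
   arbitrarily small. *)
have p0E k : segment (p i) (r i) (plane_point d (m k) (h k)) -> p i 0 0 = m k.
  move=> [s _ E]; have := congr1 (fun m : 'rV_d.+2 => m 0 0) E.
  rewrite plane_point0 !mxE => <-.
  have -> : r i 0 0 = p i 0 0 by apply/eqP; rewrite -subr_eq0 -/A A0.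
  by ring.
have : p i 0 0 = 0.
  apply: (@frequently_small_eq0 _ 1) => K.
  have [k Kk /p0E E] := iP K; exists k => //.
  by rewrite mul1r E; have [m0 m1] := mk k; rewrite gtr0_norm.
have [k _ /p0E ->] := iP 0%N; have [m0 _] := mk k.
by move=> E; rewrite E ltxx in m0.
Qed.

End zigzag_loop.
End zigzag.
Arguments zigzag_curve {R} d x.

Lemma polygonal_not_Gdelta (R : realType) d :
  ~ Gdelta (polygonal_simple_closed_curves R d.+2).
Proof.
have cg : continuous (fun p : R * R => two_graphs d (zigzag p.1) base p.2).
  pose h (p : R * R) : R * R := (p.1, Num.max p.2 0).
  have ch : continuous h.
    move=> p; apply: continuous_at_pair; first exact: cvg_fst.
    by apply: (@continuous_max _ _ snd (fun=> 0)); [exact: cvg_snd|exact: cvg_cst].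
  have cz : continuous (fun p : R * R => zigzag p.1 (Num.max p.2 0)).
    have : continuous ((fun p : R * R => zigzag p.1 p.2) \o h).
      move=> p; apply: continuous_comp; first exact: ch.
      exact: zigzag_continuous.
    exact.
  have cb : continuous (fun p : R * R => base (Num.max (- p.2) 0)).
    move=> p; apply: (@continuous_comp _ _ _ (fun p : R * R => Num.max (- p.2) 0)).
      apply: (@continuous_max _ _ (fun p : R * R => - p.2) (fun=> 0)).
        by apply: cvgN; exact: cvg_snd.
      exact: cvg_cst.
    exact: base_continuous.
  move=> p; apply: cvg_plane_point; first by apply: cvg_norm; exact: cvg_snd.
  exact: (cvgB (cz p) (cb p)).
have itv_cont : continuum (`[-1, 1] : set R).
  split; [|exact: segment_compact|exact: segment_connected].
  by exists 0; rewrite /= in_itv/=; lra.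
have cont (x : R) : continuum (zigzag_curve d x).
  apply: image_continuum => // t.
  apply: (@continuous_comp R (R * R)%type 'rV[R]_d.+2 (fun t => (x, t))
    (fun p => two_graphs d (zigzag p.1) base p.2)).
    by apply: continuous_at_pair; [exact: cvg_cst|exact: cvg_id].
  exact: cg.
pose F (x : R) : hyperspace 'rV[R]_d.+2 := exist _ _ (cont x).
have cF : continuous F.
  by apply: (hyperspace_continuous (@segment_compact R (-1) 1) cg).
move=> /(preimage_Gdelta cF); rewrite (_ : _ @^-1` _ = rational).
  exact: not_rational_Gdelta.
apply/seteqP; split=> x /=.
  by move=> [_ fu]; apply: contrapT => /(@zigzag_curve_irrational _ d); exact.
move=> xq; split; last exact: zigzag_curve_rational.
apply/simple_closed_curveP; [exact: norm_hausdorff|exact: zigzag_curve_loop].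
Qed.

(** * F-sigma *)

Section polygons.
Context {R : realType} {d k : nat}.
Implicit Types (v : 'I_k.+3 -> 'rV[R]_d) (i j : 'I_k.+3) (s t : R).

(** Addition in ['I_k.+3] is modular, so [i + 1] is the cyclic successor. With at least three
    vertices, the successor and the predecessor of [i] differ. *)
Definition edge v i s : 'rV[R]_d := (1 - s) *: v i + s *: v (i + 1).

Definition polygon v : set 'rV[R]_d := \bigcup_i segment (v i) (v (i + 1)).

(* Comparable to the distance between the points of parameters [(i, s)] and
   [(j, t)] on a regular polygon. *)
Definition gap i j s t : R :=
  if j == i then `|s - t| else
  if j == i + 1 then 1 - s + t else
  if i == j + 1 then 1 - t + s else 1.

(** These are large inequalities between continuous functions of [v], so they pass to limits, which
    mere injectivity does not. *)
Definition separated_polygon (m : R) v :=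
  (forall i, `|v i| <= m) /\
  forall i j s t, s \in `[0, 1] -> t \in `[0, 1] ->
    gap i j s t <= m * `|edge v i s - edge v j t|.

Definition simple_polygon v :=
  (forall i, v i != v (i + 1)) /\
  forall i j s t, s \in `[0, 1] -> t \in `[0, 1] -> edge v i s = edge v j t ->
    [\/ i = j, j = i + 1 /\ edge v i s = v j | i = j + 1 /\ edge v i s = v i].

Lemma polygonP v x : polygon v x <-> exists i s, s \in `[0, 1] /\ edge v i s = x.
Proof.
split=> [[i _ [s s01 <-]]|[i [s [s01 <-]]]]; first by exists i, s.
by exists i => //; exists s.
Qed.

Lemma edge0 v i : edge v i 0 = v i.
Proof. by rewrite /edge subr0 scale1r scale0r addr0. Qed.

Lemma edge1 v i : edge v i 1 = v (i + 1).
Proof. by rewrite /edge subrr scale1r scale0r add0r. Qed.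

Lemma edge_continuous v i : continuous (edge v i).
Proof.
move=> s; apply: cvgD; apply: cvgZr_tmp; last exact: cvg_id.
by apply: cvgB; [exact: cvg_cst|exact: cvg_id].
Qed.

Lemma edge_dist v w i s e : s \in `[0, 1] -> (forall i, `|v i - w i| <= e) ->
  `|edge v i s - edge w i s| <= e.
Proof.
rewrite in_itv/= => /andP[s0 s1] vw; rewrite /edge opprD addrACA -!scalerBr.
apply: le_trans (ler_normD _ _) _; rewrite !normrZ ger0_norm ?subr_ge0//.
have := vw i; have := vw (i + 1); rewrite (ger0_norm s0); nra.
Qed.

Section loop_of_polygon.
Variable v : 'I_k.+3 -> 'rV[R]_d.

Let w (n : nat) := v n%:R.

Let clamp (y : R) : R := Num.max 0 (Num.min 1 y).

(** The coefficient of index [j] grows from 0 to 1 while [x] crosses [[j, j + 1]], so the edges are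
    traversed one after the other; a finite sum of continuous terms again avoids gluing. *)
Let path n (x : R) := w 0 + \sum_(j < n) clamp (x - j%:R) *: (w j.+1 - w j).

Let path_ge n x : n%:R <= x -> path n x = w n.
Proof.
rewrite /path; elim: n => [|n IH] nx; first by rewrite big_ord0 addr0.
have n1x : n%:R + 1 <= x by rewrite natr1.
rewrite big_ord_recr /= addrA IH; last by lra.
by rewrite /clamp (min_idPl _) ?(max_idPr _) ?scale1r ?subrKC//; lra.
Qed.

Let pathE n i s : (i < n)%N -> 0 <= s -> s <= 1 ->
  path n (i%:R + s) = (1 - s) *: w i + s *: w i.+1.
Proof.
move=> + s0 s1; elim: n => // n IH; rewrite ltnS leq_eqVlt => /predU1P[->|lt_in].
  rewrite /path big_ord_recr /= addrA -/(path n _) path_ge; last by lra.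
  rewrite addrAC subrr add0r /clamp (min_idPr s1) (max_idPr s0).
  by rewrite scalerBl scale1r scalerBr addrA [in LHS]addrAC.
rewrite /path big_ord_recr /= addrA -/(path n _) IH//.
have inR : i%:R + 1 <= n%:R :> R by rewrite natr1 ler_nat.
by rewrite /clamp (min_idPr _) ?(max_idPl _) ?scale0r ?addr0//; lra.
Qed.

Let path_edge i s : s \in `[0, 1] -> path k.+3 (i%:R + s) = edge v i s.
Proof.
rewrite in_itv/= => /andP[s0 s1]; rewrite pathE// /w -natr1.
by rewrite (_ : (i : nat)%:R = i)//; exact: natr_Zp.
Qed.

Let split_param x : 0 <= x -> x < k.+3%:R ->
  exists i s, [/\ 0 <= s, s < 1 & x = (i : 'I_k.+3)%:R + s].
Proof.
move=> x0 xk; have /andP[tx xt] := truncn_itv x0.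
have ik : (Num.truncn x < k.+3)%N by rewrite -(ltr_nat R); exact: le_lt_trans xk.
exists (Ordinal ik), (x - (Num.truncn x)%:R); split=> /=.
- by rewrite subr_ge0.
- by rewrite ltrBlDl natr1.
- by rewrite subrKC.
Qed.

Let last_param : k.+3%:R = (ord_max : 'I_k.+3)%:R + 1 :> R.
Proof. by rewrite natr1. Qed.

Let clamp_continuous (j : nat) : continuous (fun x : R => clamp (x - j%:R)).
Proof.
move=> x; have cx : {for x, continuous
    ((fun=> 0) \max ((fun=> 1) \min (fun x => x - j%:R)) : R -> R)}.
  apply: continuous_max; first exact: cvg_cst.
  apply: continuous_min; first exact: cvg_cst.
  by apply: cvgB; [exact: cvg_id|exact: cvg_cst].
exact: cx.
Qed.

Lemma separated_polygon_loop m : separated_polygon m v ->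
  exists g : R -> 'rV[R]_d, simple_loop g (polygon v).
Proof.
move=> [_ sepv]; eexists; apply: (@simple_loop_rescale _ _ (path k.+3) _ 0 k.+3%:R).
- by rewrite ltr0n.
- move=> x; apply: cvgD; first exact: cvg_cst.
  apply: cvg_big => [|j _]; first exact: add_continuous.
  by apply: cvgZr_tmp; exact: clamp_continuous.
- apply/seteqP; split=> [_ [x + <-]|y /polygonP[i [s [s01 <-]]]].
    rewrite /= in_itv/= => /andP[x0]; rewrite le_eqVlt => /predU1P[->|xk].
      rewrite last_param path_edge ?bound_itvE//; apply/polygonP.
      by exists ord_max, 1; rewrite bound_itvE.
    have [i [s [s0 s1 ->]]] := split_param x0 xk.
    have s01 : s \in `[0, 1] by rewrite in_itv/= s0 ltW.
    by rewrite path_edge//; apply/polygonP; exists i, s.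
  exists (i%:R + s); last exact: path_edge.
  move: s01; rewrite /= !in_itv/= => /andP[s0 s1]; rewrite addr_ge0//=.
  by apply: (@le_trans _ _ (i%:R + 1)); rewrite ?lerD2l// natr1 ler_nat.
- have -> : path k.+3 0 = edge v ord0 0 by rewrite -path_edge ?bound_itvE// addr0.
  rewrite last_param path_edge ?bound_itvE// edge0 edge1; congr v.
  by apply/val_inj; rewrite /= (@modn_small 1)// addn1 modnn.
- move=> x y; rewrite !in_itv/= => /andP[x0 xk] /andP[y0 yk].
  have [i [s [s0 s1 ->]]] := split_param x0 xk.
  have [j [t [t0 t1 ->]]] := split_param y0 yk.
  have s01 : s \in `[0, 1] by rewrite in_itv/= s0 ltW.
  have t01 : t \in `[0, 1] by rewrite in_itv/= t0 ltW.
  rewrite !path_edge// => E; have := sepv i j s t s01 t01.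
  (* For parameters below 1, the gap between different edges is positive, so a zero distance leaves
     only [i = j] and [s = t]. *)
  rewrite E subrr normr0 mulr0 /gap; case: eqP => [->|_].
    by rewrite normr_le0 subr_eq0 => /eqP ->.
  by case: ifP => _; [lra|case: ifP => _; lra].
Qed.

End loop_of_polygon.

Lemma separated_polygon_compact m v : separated_polygon m v -> compact (polygon v).
Proof.
by move=> /separated_polygon_loop[g [cg <- _ _]]; exact: compact_image_itv.
Qed.

End polygons.

(** Compactness gives a cluster point, and a cluster point of an ultrafilter is a limit, since each
    set or its complement belongs to the ultrafilter. *)
Lemma ultra_compact_cvg {T : Type} {U : topologicalType} (F : set_system T)
    (f : T -> U) (A : set U) : UltraFilter F -> compact A -> F (f @^-1` A) ->
  exists2 p, A p & f @ F --> p.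
Proof.
move=> FU cA FA; have [p [Ap pF]] := cA _ (fmap_proper_filter f _) FA.
exists p => // B Bp; have [//|FB] := in_ultra_setVsetC (f @^-1` B) FU.
by have [y [NBy By]] := pF (~` B) B FB Bp.
Qed.

(** * Closedness of the sets of separated polygons *)

Section Fsigma.
Context {R : realType} (d : nat).

Definition separated_polygons k m : set (hyperspace 'rV[R]_d) :=
  [set C | exists2 v : 'I_k.+3 -> 'rV[R]_d,
    separated_polygon m v & sval C = polygon v].

Lemma near_hyperspace_subset (X : topologicalType) (C : hyperspace X) (O : set X) :
  open O -> sval C `<=` O -> \forall C' \near C, sval C' `<=` O.
Proof.
move=> oO CO; apply/nbhs_hyperspaceP; exists 0%N, (fun=> O); split=> //.
  split=> [x /CO Ox|_]; first by exists ord0.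
  by have [[x Cx] _ _] := svalP C; exists x; split=> //; exact: CO.
by move=> C' [C'O _] x /C'O[].
Qed.

Lemma near_hyperspace_meets (X : topologicalType) (C : hyperspace X) (O : set X) x :
  open O -> sval C x -> O x -> \forall C' \near C, O `&` sval C' !=set0.
Proof.
move=> oO Cx Ox; apply/nbhs_hyperspaceP.
(* Pairing [O] with the whole space leaves only the condition of meeting [O]. *)
exists 1%N, (fun i : 'I_2 => if i == 0 then O else setT); split.
- by move=> i; case: ifP => // _; exact: openT.
- split=> [y _|i]; first by exists 1.
  by exists x; case: ifP.
- by move=> C' [_ /(_ 0)].
Qed.

Lemma separated_polygons_closed k m : closed (separated_polygons k m).
Proof.
move=> C CF.
have PF := within_nbhs_proper CF.
(* Along an ultrafilter all the bounded vertices converge at once, with no extraction of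
   subsequences. *)
have [U [UU FU]] := ultraFilterLemma PF.
have U1 A : nbhs C A -> U A.
  by move=> CA; apply: FU; rewrite /within /=; apply: filterS CA => D AD _.
have US : U (separated_polygons k m) by apply: FU; exact: withinT.
have PU : ProperFilter U by exact: ultra_proper.
(* A choice of vertices; the default value occurs only outside the family, hence not near [U]. *)
pose V (C' : hyperspace 'rV[R]_d) := xget (fun=> 0) [set v : 'I_k.+3 -> 'rV[R]_d |
  separated_polygon m v /\ sval C' = polygon v].
have VP : \forall C' \near U, separated_polygon m (V C') /\ sval C' = polygon (V C').
  apply: filterS US => C' [v sv Cv]; rewrite /V.
  by case: xgetP => [w _ //|/(_ v)]; case.
have Vi i : exists p : 'rV[R]_d, (fun C' => V C' i) @ U --> p.
  have [||p _ pP] := @ultra_compact_cvg _ _ U (fun C' => V C' i)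
      [set x | `|x| <= m] UU; last by exists p.
  - apply: bounded_closed_compact.
      exists m; split; first exact: num_real.
      by move=> m' mm' x /= xm; apply: le_trans xm _; exact: ltW.
    rewrite (_ : mkset _ = (fun x : 'rV[R]_d => `|x|) @^-1` [set y | y <= m]); last by [].
    by apply: preimage_closed; [move=> x _; exact: norm_continuous|exact: closed_le].
  - by apply: filterS VP => C' [[+ _] _]; exact.
have [v Vv] := choice Vi.
have Ve i s : (fun C' => edge (V C') i s) @ U --> edge v i s.
  exact: (cvgD (cvgZl_tmp (Vv i)) (cvgZl_tmp (Vv (i + 1)))).
have sv : separated_polygon m v.
  split=> [i|i j s t s01 t01].
    apply: (cvgr_to_le (cvg_norm (Vv i))).
    by apply: filterS VP => C' [[+ _] _]; exact.
  apply: (cvgr_to_ge (cvgM (cvg_cst m) (cvg_norm (cvgB (Ve i s) (Ve j t))))).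
  by apply: filterS VP => C' [[_ +] _]; exact.
exists v => //; apply/seteqP; split=> x.
  (* A continuum [C'] close to [C] has a point within [e / 2] of [x], itself within [e / 2] of the
     limit polygon, which would then enter the ball of radius [e] around [x]. *)
  move=> Cx; apply: contrapT => Nvx.
  have : nbhs x (~` polygon v).
    apply: open_nbhs_nbhs; split=> //; rewrite openC.
    by apply: compact_closed; [exact: norm_hausdorff|exact: separated_polygon_compact sv].
  move=> /nbhs_ballP[e /= e0 xe].
  have e2 : 0 < e / 2 by rewrite divr_gt0.
  have near_v : \forall C' \near U, forall i, `|v i - V C' i| <= e / 2.
    by apply: filter_forall => i; have /cvgrPdist_le := Vv i; exact.
  have meets : \forall C' \near U, ball x (e / 2) `&` sval C' !=set0.
    apply: U1; apply: near_hyperspace_meets Cx _; last exact: ballxx.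
    exact: ball_open.
  have [C' [[vC' [y [xy +]]] [_ C'E]]] := filter_ex (filterI (filterI near_v meets) VP).
  rewrite C'E => /polygonP[i [s [s01 yE]]].
  apply: (xe (edge v i s)); last by apply/polygonP; exists i, s.
  rewrite -ball_normE /= (splitr e) -[x](subrK y) -addrA.
  apply: le_lt_trans (ler_normD _ _) _; apply: ltr_leD.
    by move: xy; rewrite -ball_normE.
  by rewrite distrC -yE; exact: edge_dist.
(* If this point is at distance at least [e] from [C], then every [C'] close to [C] stays farther
   than [e / 2] from it, although the corresponding point of [C'] converges to it. *)
move=> /polygonP[i [s [s01 <-]]]; apply: contrapT => NCx.
have : nbhs (edge v i s) (~` sval C).
  apply: open_nbhs_nbhs; split=> //; rewrite openC.
  by apply: compact_closed; [exact: norm_hausdorff|case: (svalP C)].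
move=> /nbhs_ballP[e /= e0 xe].
have e2 : 0 < e / 2 by rewrite divr_gt0.
have Vs : \forall C' \near U, `|edge v i s - edge (V C') i s| <= e / 2.
  by have /cvgrPdist_le := Ve i s; exact.
have avoid : \forall C' \near U,
    sval C' `<=` [set y | e / 2 < `|edge v i s - y|].
  apply: U1; apply: near_hyperspace_subset.
    rewrite (_ : mkset _ = (fun y => `|edge v i s - y|) @^-1` [set y | e / 2 < y]).
      apply: open_comp; last exact: open_gt.
      by move=> y _; exact: (cvg_norm (cvgB (cvg_cst _) cvg_id)).
    by [].
  move=> y Cy /=; rewrite ltNge; apply/negP => ey; apply: (xe y) Cy.
  rewrite -ball_normE /=; apply: le_lt_trans ey _.
  by rewrite ltr_pdivrMr// ltr_pMr// ltr1n.
have [C' [[C'1 C'2] [_ C'E]]] := filter_ex (filterI (filterI Vs avoid) VP).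
have /C'2 /= : sval C' (edge (V C') i s).
  by rewrite C'E; apply/polygonP; exists i, s.
by rewrite ltNge C'1.
Qed.

End Fsigma.

(** * Simple polygons are separated *)

Section separation.
Context {R : realType} {d k : nat}.
Variable v : 'I_k.+3 -> 'rV[R]_d.
Hypothesis sv : simple_polygon v.
Implicit Types (i j : 'I_k.+3) (s t : R).

Lemma edge_sub i s t : edge v i s - edge v i t = (s - t) *: (v (i + 1) - v i).
Proof. by apply/rowP => l; rewrite !mxE; ring. Qed.

Lemma ordS_neq i : (i + 1 == i) = false.
Proof. by rewrite -{2}[i]addr0 (inj_eq (addrI i)) oner_eq0. Qed.

Lemma ordSS_neq i : (i + 1 + 1 == i) = false.
Proof.
rewrite -{2}[i]addr0 -addrA (inj_eq (addrI i)); apply/eqP => /(congr1 val).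
by rewrite /= !(modn_small, addn1).
Qed.

(** Both edges issue from [v (i + 1)], so the difference of the two points is homogeneous in
    [(1 - s, t)]. Scaling to [1 - s + t = 1] leaves a single parameter in [[0, 1]], over which the
    distance has a minimum. *)
Lemma consecutive_edges_separated i : exists2 c : R, 0 < c &
  forall s t, s \in `[0, 1] -> t \in `[0, 1] ->
    c * (1 - s + t) <= `|edge v i s - edge v (i + 1) t|.
Proof.
pose f l := `|edge v i l - edge v (i + 1) l|.
have cf : {within `[0, 1], continuous f}.
  apply: continuous_subspaceT => l.
  exact: (cvg_norm (cvgB (@edge_continuous _ _ _ v i l)
    (@edge_continuous _ _ _ v (i + 1) l))).
have [c c01 cmin] := EVT_min ler01 cf.
exists (f c) => [|s t]; last first.
  rewrite !in_itv/= => /andP[s0 s1] /andP[t0 t1].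
  have : 0 <= 1 - s + t by lra.
  rewrite le_eqVlt => /predU1P[<-|st]; first by rewrite mulr0.
  have l01 : t / (1 - s + t) \in `[0, 1].
    rewrite in_itv/= divr_ge0//= ?ler_pdivrMr//; lra.
  apply: le_trans (ler_wpM2r (ltW st) (cmin _ l01)) _.
  rewrite /f; have -> : edge v i s - edge v (i + 1) t = (1 - s + t) *:
      (edge v i (t / (1 - s + t)) - edge v (i + 1) (t / (1 - s + t))).
    by apply/rowP => l; rewrite !mxE; field; exact: lt0r_neq0.
  by rewrite normrZ (gtr0_norm st) mulrC.
rewrite /f normr_gt0 subr_eq0; apply/negP => /eqP E.
have [vne /(_ _ _ _ _ c01 c01 E)[/esym/eqP|[_ vi]|[/esym/eqP]]] := sv.
- by rewrite ordS_neq.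
(* The common point is the shared vertex, of parameter 1 on the first edge and 0 on the second; [c]
   cannot be both. *)
- have : edge v i c - edge v i 1 = 0 by rewrite edge1 vi subrr.
  have : edge v (i + 1) c - edge v (i + 1) 0 = 0 by rewrite edge0 -E vi subrr.
  rewrite !edge_sub => /eqP; rewrite subr0 scaler_eq0 subr_eq0 [_ == v (i + 1)]eq_sym.
  rewrite (negbTE (vne _)) orbF => /eqP -> /eqP.
  rewrite scaler_eq0 !subr_eq0 [_ == v i]eq_sym (negbTE (vne _)) orbF => /eqP; lra.
- by rewrite ordSS_neq.
Qed.

Lemma edges_separated i j : exists2 c : R, 0 < c &
  forall s t, s \in `[0, 1] -> t \in `[0, 1] ->
    c * gap i j s t <= `|edge v i s - edge v j t|.
Proof.
rewrite /gap; have [->|ij] := eqVneq j i.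
  exists `|v (i + 1) - v i|.
    by rewrite normr_gt0 subr_eq0 eq_sym; exact: sv.1.
  by move=> s t _ _; rewrite edge_sub normrZ mulrC.
have [->|ij1] := eqVneq j (i + 1); first exact: consecutive_edges_separated.
have [->|ji1] := eqVneq i (j + 1).
  have [c c0 cP] := consecutive_edges_separated j; exists c => // s t s01 t01.
  by rewrite distrC; exact: cP.
(* Edges that are neither equal nor adjacent are disjoint, so their distance has a positive minimum
   over the square of parameters. *)
pose f (p : R * R) := `|edge v i p.1 - edge v j p.2|.
have cf : {within `[0, 1] `*` `[0, 1], continuous f}.
  apply: continuous_subspaceT => p; apply: cvg_norm; apply: cvgB.
    exact: (@continuous_comp _ _ _ (@fst R R) _ _ cvg_fst (@edge_continuous R d k v i _)).
  exact: (@continuous_comp _ _ _ (@snd R R) _ _ cvg_snd (@edge_continuous R d k v j _)).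
have [||[s t] + cmin] := compact_EVT_min _ _ cf.
- by exists (0, 0); split; rewrite /= bound_itvE.
- by apply: compact_setX; exact: segment_compact.
rewrite inE => -[/= s01 t01]; exists (f (s, t)); last first.
  by move=> s' t' s01' t01'; rewrite mulr1; apply: (cmin (s', t')); rewrite inE.
rewrite /f normr_gt0 subr_eq0; apply/negP => /eqP E.
by have [_ /(_ _ _ _ _ s01 t01 E)[ijE|[jE _]|[iE _]]] := sv;
  [rewrite ijE eqxx in ij|rewrite jE eqxx in ij1|rewrite iE eqxx in ji1].
Qed.

(** Finitely many pairs of edges give one common constant; taking it in [nat] keeps the family of
    closed sets countable. *)
Lemma simple_polygon_separated : exists m : nat, separated_polygon m%:R v.
Proof.
have bnd (p : 'I_k.+3 * 'I_k.+3) : exists m : nat, forall s t,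
    s \in `[0, 1] -> t \in `[0, 1] ->
    gap p.1 p.2 s t <= m%:R * `|edge v p.1 s - edge v p.2 t|.
  have [c c0 cP] := edges_separated p.1 p.2; exists (Num.truncn c^-1).+1 => s t s01 t01.
  have := cP s t s01 t01; rewrite mulrC -ler_pdivlMr// mulrC => /le_trans; apply.
  by apply: ler_wpM2r => //; apply/ltW/truncnS_gt.
have [f fP] := choice bnd.
exists (maxn (\max_i (Num.truncn `|v i|).+1) (\max_p f p)); split=> [i|i j s t s01 t01].
  apply/ltW; apply: lt_le_trans (truncnS_gt _) _.
  by rewrite ler_nat leq_max (leq_bigmax i).
apply: le_trans (fP (i, j) s t s01 t01) _ => /=.
by apply: ler_wpM2r => //; rewrite ler_nat leq_max (leq_bigmax (i, j)) orbT.
Qed.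

End separation.

(** * Order of points on a segment *)

Section segments.
Context {R : realType} {d : nat}.
Implicit Types a b x u w : 'rV[R]_d.

Lemma segmentP a b x : segment a b x <->
  exists t, [/\ 0 <= t, t <= 1 & x = a + t *: (b - a)].
Proof.
have E t : (1 - t) *: a + t *: b = a + t *: (b - a).
  by apply/rowP => l; rewrite !mxE; ring.
split=> [[t + <-]|[t [t0 t1 ->]]].
  by rewrite /= in_itv/= => /andP[t0 t1]; exists t.
by exists t; rewrite /= ?in_itv/= ?t0.
Qed.

Lemma segment_left a b : segment a b a.
Proof. by apply/segmentP; exists 0; rewrite scale0r addr0. Qed.

Lemma segment_right a b : segment a b b.
Proof. by apply/segmentP; exists 1; rewrite scale1r subrKC. Qed.

Lemma connected_segment a b : connected (segment a b).
Proof.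
apply: connected_continuous_connected; first exact: segment_connected.
apply: continuous_subspaceT => t; apply: cvgD; apply: cvgZr_tmp; last exact: cvg_id.
by apply: cvgB; [exact: cvg_cst|exact: cvg_id].
Qed.

Lemma segment_sub a b x w : segment a b x -> segment a b w ->
  segment x w `<=` segment a b.
Proof.
move=> /segmentP[r [r0 r1 ->]] /segmentP[p [p0 p1 ->]] _ /segmentP[q [q0 q1 ->]].
apply/segmentP; exists (r + q * (p - r)); split; [nra|nra|].
by apply/rowP => l; rewrite !mxE; ring.
Qed.

Lemma segmentC a b : segment a b = segment b a.
Proof.
by apply/seteqP; split; apply: segment_sub; (exact: segment_left || exact: segment_right).
Qed.

Lemma segment_inter a b x u : segment a b x -> segment x a u -> segment x b u ->
  u = x.
Proof.
move=> /segmentP[r [r0 r1 xE]] /segmentP[p [p0 p1 uE]] /segmentP[q [q0 q1 uE']].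
have u1 : u - x = - (p * r) *: (b - a).
  by rewrite uE xE; apply/rowP => l; rewrite !mxE; ring.
have u2 : u - x = (q * (1 - r)) *: (b - a).
  by rewrite uE' xE; apply/rowP => l; rewrite !mxE; ring.
have /eqP : (p * r + q * (1 - r)) *: (b - a) = 0.
  by rewrite scalerDl -u2 u1 -scalerDl subrr scale0r.
rewrite scaler_eq0 => /orP[/eqP pq|/eqP ba]; apply/eqP; rewrite -subr_eq0 u1.
  have -> : p * r = 0 by nra.
  by rewrite oppr0 scale0r.
by rewrite ba scaler0.
Qed.

Lemma segment_between a b x u w : segment a b x -> segment x a u ->
  segment x b w -> segment u w x.
Proof.
move=> /segmentP[r [r0 r1 xE]] /segmentP[p [p0 p1 uE]] /segmentP[q [q0 q1 wE]].
have u1 : u = x - (p * r) *: (b - a).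
  by rewrite uE xE; apply/rowP => l; rewrite !mxE; ring.
have w1 : w = x + (q * (1 - r)) *: (b - a).
  by rewrite wE xE; apply/rowP => l; rewrite !mxE; ring.
have P0 : 0 <= p * r by rewrite mulr_ge0.
have Q0 : 0 <= q * (1 - r) by rewrite mulr_ge0// subr_ge0.
(* In units of [b - a], [u] lies [P] before [x] and [w] lies [Q] after it, so [x] divides the
   segment from [u] to [w] in the ratio [P : Q]. *)
move: (p * r) (q * (1 - r)) P0 Q0 u1 w1 => P Q P0 Q0 -> ->.
have [PQ|PQ] := eqVneq (P + Q) 0.
  have -> : P = 0 by lra.
  by rewrite scale0r subr0; exact: segment_left.
have PQ0 : 0 < P + Q by rewrite lt_neqAle eq_sym PQ addr_ge0.
apply/segmentP; exists (P / (P + Q)); split.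
- by rewrite divr_ge0// ltW.
- by rewrite ler_pdivrMr// mul1r lerDl.
- by apply/rowP => l; rewrite !mxE; field.
Qed.

End segments.

(** * Arcs of a loop covered by segments are straight *)

Section loop_arcs.
Context {R : realType} {d : nat}.
Variables (g : R -> 'rV[R]_d) (C : set 'rV[R]_d).
Hypothesis gl : simple_loop g C.

Let loop_closed (a b : R) : closed (g @` `[a, b]).
Proof.
apply: compact_closed; first exact: norm_hausdorff.
by have [cg _ _ _] := gl; exact: compact_image_itv.
Qed.

(* Removing two points of a loop separates the two arcs between them. *)
Lemma connected_meets_endpoint (A : set 'rV[R]_d) (x y z u : R) :
  connected A -> A `<=` C -> 0 <= y -> y <= x -> x <= z -> z <= 1 ->
  0 <= u -> u <= 1 -> u <= y \/ z <= u -> A (g x) -> A (g u) ->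
  A (g y) \/ A (g z).
Proof.
move=> cA AC y0 yx xz z1 u0 u1 uyz Ax Au; apply: contrapT => /not_orP[Ay Az].
pose C1 := g @` `[y, z]; pose C2 := g @` `[0, y] `|` g @` `[z, 1].
have yz := le_trans yx xz.
have disj a : A a -> C1 a -> C2 a -> False.
  move=> Aa [p + pa] C2a; rewrite /= in_itv/= => /andP[yp pz].
  have [q [q0 q1 qa qyz]] : exists q, [/\ 0 <= q, q <= 1, g q = a & q <= y \/ z <= q].
    case: C2a => -[q + qa]; rewrite /= in_itv/= => /andP[q0 q1]; exists q.
      by split=> //; [rewrite (le_trans q1)// (le_trans yz)|left].
    by split=> //; [rewrite (le_trans _ q0)// (le_trans y0)|right].
  have p01 : p \in `[0, 1] by rewrite in_itv/= (le_trans y0)//= (le_trans pz).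
  have q01 : q \in `[0, 1] by rewrite in_itv/= q0.
  have /(simple_loop_inj gl p01 q01)[pq|[pE qE]|[pE qE]] : g p = g q by rewrite pa qa.
  - case: qyz => qyz.
      by apply: Ay; rewrite (_ : y = p) ?pa//; lra.
    by apply: Az; rewrite (_ : z = p) ?pa//; lra.
  - by apply: Ay; rewrite (_ : y = p) ?pa//; lra.
  - by apply: Az; rewrite (_ : z = p) ?pa//; lra.
have cover a : A a -> ~ C2 a -> C1 a.
  have [_ gC _ _] := gl.
  move=> /AC; rewrite -gC => -[p + <-] C2p; rewrite /= in_itv/= => /andP[p0 p1].
  exists p => //; rewrite /= in_itv/=.
  apply/andP; split; rewrite leNgt; apply/negP => H; apply: C2p.
    by left; exists p => //; rewrite /= in_itv/= p0 ltW.
  by right; exists p => //; rewrite /= in_itv/= p1 ltW.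
(* The two arcs meet only at [g y] and [g z], which [A] avoids; so the trace of [C1] on [A] is
   closed, and open as the trace of the complement of [C2]. *)
have : A `&` C1 = A.
  apply: cA.
  - by exists (g x); split=> //; exists x => //; rewrite /= in_itv/= yx.
  - exists (~` C2).
      by rewrite openC; apply: closedU; exact: loop_closed.
    apply/seteqP; split=> a [Aa C1a]; split=> //; first exact: disj C1a.
    exact: cover.
  - by exists C1 => //; exact: loop_closed.
move=> AE; have [_ C1u] : (A `&` C1) (g u) by rewrite AE.
apply: (disj (g u)) => //; case: uyz => H; [left|right]; exists u => //.
  by rewrite /= in_itv/= u0.
by rewrite /= in_itv/= H.
Qed.

Section arc.
Variables (th th' : R).
Hypotheses (th0 : 0 <= th) (thth' : th < th') (th'1 : th' <= 1).
Hypothesis th01 : ~ (th = 0 /\ th' = 1).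

Let thI : th \in `[0, 1].
Proof. by rewrite in_itv/= th0 ltW// (lt_le_trans thth'). Qed.

Let th'I : th' \in `[0, 1].
Proof. by rewrite in_itv/= th'1 ltW// (le_lt_trans th0). Qed.

(** Each half of the segment, from [g x] to [a] or to [b], is connected and leaves the arc, hence
    contains [g th] or [g th']. A point common to both halves would be [g x], against injectivity;
    so the halves contain different ends. *)
Lemma arc_between (a b : 'rV[R]_d) (al be x : R) :
  segment a b `<=` C -> 0 <= al -> al <= 1 -> 0 <= be -> be <= 1 ->
  g al = a -> g be = b -> al <= th \/ th' <= al -> be <= th \/ th' <= be ->
  th < x -> x < th' -> segment a b (g x) -> segment (g th) (g th') (g x).
Proof.
move=> abC al0 al1 be0 be1 ga gb alN beN thx xth' abx.
have ends p u : 0 <= u -> u <= 1 -> u <= th \/ th' <= u -> g u = p ->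
    segment a b p -> segment (g x) p (g th) \/ segment (g x) p (g th').
  move=> u0 u1 uN gu abp.
  have sC : segment (g x) p `<=` C.
    by apply: subset_trans abC; exact: segment_sub.
  apply: (connected_meets_endpoint _ sC th0 (ltW thx) (ltW xth') th'1 u0 u1 uN).
  - exact: connected_segment.
  - exact: segment_left.
  - by rewrite gu; exact: segment_right.
have [H0 H1 H2] := And3 th0 thth' th'1.
have xI : x \in `[0, 1] by rewrite in_itv/=; lra.
have Nth : g th <> g x.
  by move=> /(simple_loop_inj gl thI xI)[?|[? ?]|[? ?]]; lra.
have Nth' : g th' <> g x.
  by move=> /(simple_loop_inj gl th'I xI)[?|[? ?]|[? ?]]; lra.
have [ua|ua] := ends a al al0 al1 alN ga (segment_left _ _);
  have [ub|ub] := ends b be be0 be1 beN gb (segment_right _ _).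
- by case: Nth; exact: segment_inter abx ua ub.
- exact: segment_between abx ua ub.
- by rewrite segmentC in abx; exact: segment_between abx ub ua.
- by case: Nth'; exact: segment_inter abx ua ub.
Qed.

Lemma arc_segment : (forall x, th < x -> x < th' -> segment (g th) (g th') (g x)) ->
  g @` `[th, th'] = segment (g th) (g th').
Proof.
have [H0 H1 H2] := And3 th0 thth' th'1.
move=> H; have sub x : x \in `[th, th'] -> segment (g th) (g th') (g x).
  rewrite in_itv/= => /andP[]; rewrite le_eqVlt => /predU1P[<- _|thx].
    exact: segment_left.
  by rewrite le_eqVlt => /predU1P[->|/H]; [exact: segment_right|exact].
apply/seteqP; split=> [_ [x xI <-]|y]; first exact: sub.
move=> /segmentP[s [s0 s1 ->]].
(* The arc is not the whole loop, so its ends differ in some coordinate [l]. From this coordinate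
   [la] reads the parameter along the chord, and the intermediate value theorem reaches every point
   of the chord. *)
have /eqP/rowP/existsNP[l /eqP gl0] : g th' != g th.
  by apply/eqP => /(simple_loop_inj gl th'I thI)[?|[? ?]|[? ?]]; [lra|lra|exact: th01].
pose la t := (g t 0 l - g th 0 l) / (g th' 0 l - g th 0 l).
have den : g th' 0 l - g th 0 l != 0 by rewrite subr_eq0.
have cla : {within `[th, th'], continuous la}.
  apply: continuous_subspaceT => t; apply: cvgM; last exact: cvg_cst.
  apply: cvgB; last exact: cvg_cst.
  apply: (@continuous_comp _ _ _ g (fun m : 'rV[R]_d => m 0 l)).
    by have [cg _ _ _] := gl; exact: cg.
  exact: coord_continuous.
have [||c cI lac] := @IVT R la th th' s _ cla; first exact: ltW.
  by rewrite /la subrr mul0r divff// (min_idPl _) ?(max_idPr _)// s0.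
exists c => //; have /segmentP[s' [_ _ gc]] := sub c cI.
rewrite gc; congr (_ + _ *: _); rewrite -lac /la gc !mxE; field.
exact: den.
Qed.

End arc.
End loop_arcs.

(** * Partitions of the unit interval *)

Section partitions.
Context {R : realType}.

Lemma uniq_thirds : uniq [:: 0; 3^-1; 2 / 3; 1 : R].
Proof.
rewrite /= !in_cons !in_nil !orbF !negb_or -!andbA; do ?[apply/andP; split] => //;
  by apply/eqP; lra.
Qed.

(** The list is sorted without repetition, so an element has index at most [j] or at least [j.+1]
    and is never inside an interval. The bound on [n] serves to guarantee enough intervals. *)
Lemma sorted_partition (s : seq R) : {subset s <= `[0, 1]} -> 0 \in s -> 1 \in s ->
  exists n (th : nat -> R), [/\ th 0 = 0, th n = 1,
    forall i j, (i < j)%N -> (j <= n)%N -> th i < th j,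
    forall x j, x \in s -> (j < n)%N -> x <= th j \/ th j.+1 <= x &
    ((size (undup s)).-1 <= n)%N].
Proof.
move=> s01 s0 s1; pose t := sort <=%O (undup s).
have ts x : (x \in t) = (x \in s) by rewrite mem_sort mem_undup.
have st : sorted <%O t by rewrite sort_lt_sorted undup_uniq.
have t0 : (0 < size t)%N by rewrite -has_predT; apply/hasP; exists 0; rewrite ?ts.
pose th j := nth 0 t j.
have lt_th i j : (i < size t)%N -> (j < size t)%N -> (th i < th j) = (i < j)%N.
  by move=> it jt; rewrite /th lt_sorted_ltn_nth.
have le_th i j : (i < size t)%N -> (j < size t)%N -> (th i <= th j) = (i <= j)%N.
  by move=> it jt; rewrite leNgt lt_th// [RHS]leqNgt.
have thI j : (j < size t)%N -> 0 <= th j <= 1.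
  by move=> jt; have /s01 : th j \in s; [rewrite -ts mem_nth|rewrite in_itv].
have idx x : x \in s -> (index x t < size t)%N /\ th (index x t) = x.
  by move=> xs; rewrite index_mem ts; split=> //; rewrite /th nth_index// ts.
have lt_pred : ((size t).-1 < size t)%N by rewrite prednK.
exists (size t).-1, th; split.
- have [i0 E] := idx _ s0; apply/eqP; rewrite eq_le -{1}E le_th//=.
  by have /andP[-> _] := thI _ t0.
- have [i1 E] := idx _ s1; apply/eqP; rewrite eq_le -{2}E le_th//=.
    by have /andP[_ ->] := thI _ lt_pred; rewrite -ltnS prednK.
- move=> i j ij jn; have jt : (j < size t)%N by exact: leq_ltn_trans lt_pred.
  by rewrite lt_th// (ltn_trans ij).
- move=> x j xs jn; have [it E] := idx _ xs; rewrite -E.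
  have jt : (j.+1 < size t)%N by rewrite -(prednK t0) ltnS.
  have [ij|ji] := leqP (index x t) j; [left|right].
    by rewrite le_th// (ltn_trans _ jt).
  by rewrite le_th.
- by rewrite size_sort.
Qed.

Lemma partition_cover n (th : nat -> R) (x : R) : (0 < n)%N -> th 0 <= x -> x <= th n ->
  exists j, [/\ (j < n)%N, th j <= x & x <= th j.+1].
Proof.
elim: n => // -[_ _ x0 x1|n IH _ x0 xn]; first by exists 0%N.
have [xn1|/ltW nx] := leP x (th n.+1); last by exists n.+1.
have [j [jn jx xj]] := IH isT x0 xn1; exists j; split=> //; exact: ltnW.
Qed.

End partitions.

(** * From polygonal loops to simple polygons *)

Section extraction.
Context {R : realType} {d : nat}.

Lemma polygonal_loop_simple_polygon (g : R -> 'rV[R]_d) (C : set 'rV[R]_d) :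
  simple_loop g C -> finite_union_of_segments C ->
  exists k (v : 'I_k.+3 -> 'rV[R]_d), simple_polygon v /\ C = polygon v.
Proof.
move=> gl [N [a [b [_ CE]]]].
have gP := simple_loopP gl; have [_ gC g01 _] := gl.
have Cg x : x \in `[0, 1] -> C (g x) by move=> xI; rewrite -gC; exists x.
have gI p : C p -> exists2 x, x \in `[0, 1] & g x = p by rewrite -gC.
have {CE}CE p : C p <-> (\bigcup_i segment (a i) (b i)) p by rewrite CE.
clear gC.
have pre (c : 'I_N -> 'rV[R]_d) : (forall i, C (c i)) ->
    exists al : 'I_N -> R, forall i, al i \in `[0, 1] /\ g (al i) = c i.
  move=> Cc; have ex i : exists t, t \in `[0, 1] /\ g t = c i.
    have [t t01 gt] := (gP _).1 (Cc i).
    by exists t; split=> //; exact: subset_itv_co_cc.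
  by have [al alP] := choice ex; exists al.
have sC i : segment (a i) (b i) `<=` C by move=> p ip; apply/CE; exists i.
have [al alP] := pre a (fun i => sC i _ (segment_left _ _)).
have [be beP] := pre b (fun i => sC i _ (segment_right _ _)).
(* The four fixed parameters force at least three arcs, hence at least three vertices. *)
pose s := [:: 0; 3^-1; 2 / 3; 1] ++ codom al ++ codom be.
have als i : al i \in s by rewrite !mem_cat codom_f ?orbT.
have bes i : be i \in s by rewrite !mem_cat codom_f ?orbT.
have [|||n [th [th0 thn th_lt th_s sn]]] := @sorted_partition R s.
- move=> x; rewrite !mem_cat => /or3P[|/codomP[i ->]|/codomP[i ->]].
  + by rewrite !in_cons in_nil orbF => /or4P[] /eqP ->; rewrite in_itv/=; lra.
  + exact: (alP i).1.
  + exact: (beP i).1.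
- by rewrite !inE eqxx.
- by rewrite !inE eqxx !orbT.
have n3 : (2 < n)%N.
  apply: leq_trans sn; rewrite -ltnS prednK; last first.
    by rewrite -has_predT; apply/hasP; exists 0; rewrite // mem_undup mem_head.
  apply: (@uniq_leq_size _ [:: 0; 3^-1; 2 / 3; 1 : R]); last first.
    by move=> x xs; rewrite mem_undup mem_cat xs.
  exact: uniq_thirds.
have [k nE] : exists k, n = k.+3 by exists (n - 3)%N; rewrite -addn3 subnK.
subst n.
have th_le i j : (i <= j)%N -> (j <= k.+3)%N -> th i <= th j.
  by rewrite leq_eqVlt => /predU1P[->//|ij] /(th_lt _ _ ij)/ltW.
have th_inj i j : (i <= k.+3)%N -> (j <= k.+3)%N -> th i = th j -> i = j.
  move=> ik jk E; have [ij|ji|//] := ltngtP i j.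
    by have := th_lt _ _ ij jk; rewrite E ltxx.
  by have := th_lt _ _ ji ik; rewrite E ltxx.
have th01 i : (i <= k.+3)%N -> 0 <= th i <= 1.
  by move=> ik; rewrite -{1}th0 -thn !th_le.
have arc i : (i < k.+3)%N -> g @` `[th i, th i.+1] = segment (g (th i)) (g (th i.+1)).
  move=> ik; have /andP[i0 _] := th01 i (ltnW ik); have /andP[_ i1] := th01 i.+1 ik.
  have ii := th_lt _ _ (ltnSn i) ik.
  have Nii : ~ (th i = 0 /\ th i.+1 = 1).
    rewrite -{1}th0 -thn => -[/th_inj E /th_inj E'].
    by have := E' ik (leqnn _); rewrite E ?(ltnW ik).
  apply: (arc_segment gl i0 ii i1 Nii) => x ix xi.
  have /Cg/CE [l _ lx] : x \in `[0, 1] by rewrite in_itv/=; lra.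
  have [al01 gal] := alP l; have [be01 gbe] := beP l.
  rewrite !in_itv/= in al01 be01.
  have /andP[al0 al1] := al01; have /andP[be0 be1] := be01.
  exact: (arc_between gl i0 ii i1 (sC l) al0 al1 be0 be1 gal gbe
    (th_s _ _ (als l) ik) (th_s _ _ (bes l) ik) ix xi lx).
pose v (i : 'I_k.+3) := g (th i).
have ordS (i : 'I_k.+3) : (i.+1 < k.+3)%N -> (i + 1 : 'I_k.+3) = i.+1 :> nat.
  by move=> ik; rewrite /= (@modn_small 1)// addn1 modn_small.
have ordS_max (i : 'I_k.+3) : i.+1 = k.+3 -> i + 1 = ord0.
  by move=> ik; apply/val_inj; rewrite /= (@modn_small 1)// addn1 ik modnn.
have vS (i : 'I_k.+3) : v (i + 1) = g (th i.+1).
  have := ltn_ord i; rewrite leq_eqVlt => /predU1P[ik|ik].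
    by rewrite /v ordS_max//= th0 ik thn.
  by rewrite /v ordS.
have edgeP (i : 'I_k.+3) t : t \in `[0, 1] ->
    exists2 x, th i <= x <= th i.+1 & g x = edge v i t.
  move=> t01; have : segment (g (th i)) (g (th i.+1)) (edge v i t).
    by rewrite -vS; exists t.
  by rewrite -(arc i (ltn_ord i)) => -[x xI gx]; exists x.
have CvE : C = polygon v.
  apply/seteqP; split=> [p|_ /polygonP[i [t [t01 <-]]]].
    move=> /gI[x + <-]; rewrite in_itv/= => /andP[x0 x1].
    have [||i [ik ix xi]] := @partition_cover R k.+3 th x isT; rewrite ?th0 ?thn//.
    exists (Ordinal ik) => //; rewrite vS -(arc i ik); exists x => //.
    by rewrite /= in_itv/= ix.
  have [x /andP[ix xi] <-] := edgeP i t t01.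
  have /andP[i0 _] := th01 i (ltnW (ltn_ord i)).
  have /andP[_ i1] := th01 i.+1 (ltn_ord i).
  by apply: Cg; rewrite in_itv/=; lra.
exists k, v; split=> //; clear CvE; split=> [i|].
  rewrite vS; apply/eqP => /(simple_loop_inj gl (th01 _ (ltnW (ltn_ord i)))
    (th01 _ (ltn_ord i)))[|[]|[]].
  - by move=> /th_inj E; have /eqP := E (ltnW (ltn_ord i)) (ltn_ord i); rewrite ltn_eqF.
  - rewrite -{1}th0 -{1}thn => /th_inj E /th_inj E'.
    by have := E' (ltn_ord i) (leqnn _); rewrite E ?(ltnW (ltn_ord i)).
  - move=> E E'; have := th_lt _ _ (ltnSn i) (ltn_ord i); rewrite E E'; lra.
(* For [i < j], a common point has either equal parameters, which must be [th i.+1 = th j], or the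
   parameters 0 and 1, which makes [i] the first edge and [j] the last one. *)
have meet (i j : 'I_k.+3) s' t : (i <= j)%N -> s' \in `[0, 1] -> t \in `[0, 1] ->
    edge v i s' = edge v j t ->
    [\/ i = j, j = i + 1 /\ edge v i s' = v j | i = j + 1 /\ edge v i s' = v i].
  rewrite leq_eqVlt => /predU1P[ij _ _ _|ij]; first by constructor 1; exact/val_inj.
  move=> s01 t01 E.
  have [x /andP[ix xi] gx] := edgeP i s' s01; have [y /andP[jy yj] gy] := edgeP j t t01.
  have ik := ltn_ord i; have jk := ltn_ord j.
  have ij1 := th_le _ _ ij (ltnW jk).
  have /andP[i0 i1] := th01 i (ltnW ik); have /andP[j0 j1] := th01 j.+1 jk.
  have /andP[j0' j1'] := th01 j (ltnW jk).
  have xI : x \in `[0, 1] by rewrite in_itv/=; lra.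
  have yI : y \in `[0, 1] by rewrite in_itv/=; lra.
  have /(simple_loop_inj gl xI yI)[xy|[xE yE]|[xE yE]] : g x = g y by rewrite gx gy.
  - have /th_inj ijE : th i.+1 = th j by lra.
    have {}ijE : i.+1 = j by apply: ijE => //; exact: ltnW.
    constructor 2; split; last by rewrite -gx /v; congr g; lra.
    by apply/ord_inj; rewrite ordS ijE.
  - have /th_inj iE : th i = th 0%N by rewrite th0; lra.
    have {}iE := iE (ltnW ik) isT.
    have /th_inj jE : th j.+1 = th k.+3 by rewrite thn; lra.
    have {}jE := jE jk (leqnn _).
    constructor 3; split.
      by rewrite ordS_max//; exact/val_inj.
    by rewrite -gx /v iE th0 xE.
  - by have := le_trans xi (le_trans ij1 jy); rewrite xE yE ler10.
move=> i j s' t s01 t01 E; have [ij|/ltnW ji] := leqP i j; first exact: meet E.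
have [ji'|[iE H]|[jE H]] := meet _ _ _ _ ji t01 s01 (esym E).
- by constructor 1.
- by constructor 3; rewrite E.
- by constructor 2; rewrite E.
Qed.

End extraction.

Lemma polygonal_Fsigma (R : realType) d :
  Fsigma (polygonal_simple_closed_curves R d).
Proof.
pose F (i : nat) : set (hyperspace 'rV[R]_d) :=
  (* The default pair contributes the empty set: for [m = 0], the gap 1 between the ends of an edge
     cannot be bounded. *)
  let km := odflt (0%N, 0%N) (unpickle i) in separated_polygons km.1 km.2%:R.
exists F; first by move=> i; exact: separated_polygons_closed.
apply/seteqP; split=> [C [/simple_closed_curveP[|g gl] fu]|C [i _ [v sv Cv]]].
- exact: norm_hausdorff.
- have [k [v [sv Cv]]] := polygonal_loop_simple_polygon gl fu.
  have [m mv] := simple_polygon_separated sv.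
  by exists (pickle (k, m)) => //; rewrite /F pickleK /=; exists v.
split.
  apply/simple_closed_curveP; first exact: norm_hausdorff.
  by rewrite Cv; exact: separated_polygon_loop sv.
eexists; eexists; eexists; split; last by rewrite Cv; reflexivity.
(* The two ends of a degenerate edge would have gap 1 and distance 0. *)
move=> j /=; apply/negP => /eqP vj.
have [_ /(_ j j 0 1)] := sv; rewrite edge0 edge1 /gap eqxx -vj subrr normr0 mulr0.
by rewrite !bound_itvE !ler01 sub0r normrN normr1 ler10 => /(_ isT isT).
Qed.

Theorem theorem3p1 (R : realType) :
  (Fsigma (simple_closed_polygons R) /\ ~ Gdelta (simple_closed_polygons R)) /\
  (Fsigma (polygonal_knots R) /\ ~ Gdelta (polygonal_knots R)).
Proof.
by split; split; (exact: polygonal_Fsigma || exact: polygonal_not_Gdelta).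
Qed.
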